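(* Let $A\in\mathbb{R}^{M\times N}$ be the collocation matrix of the univariate non-periodic approximation problem with the periodized Gaussian RBF, with shape parameter determined by $\tau_0>0$ through $\varepsilon=cN$, $c=\frac{\pi}{2T\sqrt{2\log(1+\tau_0^{-2})}}$, and let $Z^*=FB^\dagger PE$. If the discrete least squares problem $A\mathbf{a}=b$ has a solution $\tilde x\in\mathbb{R}^N$ satisfying $$\|b-A\tilde x\|\le C\tau_0,\qquad \|\tilde x\|\le D,$$ for some constants $C,D>0$, then a solution $\mathbf{x}$ of the AZ algorithm exists that satisfies $$\|A\mathbf{x}-b\|\le C\tau_0\quad\text{and}\quad \|\mathbf{x}\|\le E_0,$$ for some constant $E_0>0$ independent of $\tau_0$.
   Context: Let $T>1$, let $N, s$ be positive integers and $L=sN$. The Gaussian RBF is $\phi(r)=e^{-\varepsilon^2r^2}$ and $\phi^{\rm per}(x) = \sum_{m=-\infty}^{\infty}\phi(x-2mT)$. The centers are $c_j=-T+(j-1)\frac{2T}{N}$, $j=1,\dots,N$; the grid points are $\tilde x_i=-T+(i-1)\frac{2T}{L}$, $i=1,\dots,L$; the basis functions are $\phi_j(x)=\phi^{\rm per}(x-c_j)$. The matrix $A^{\rm c}\in\mathbb{R}^{L\times N}$ has entries $A^{\rm c}_{ij}=\phi_j(\tilde x_i)$. The permutation matrix $\Pi\in\mathbb{R}^{L\times L}$ reorders the rows so that $\Pi A^{\rm c}$ is the vertical stack of $N\times N$ circulant blocks $A^{\rm c}_1,\dots,A^{\rm c}_s$, where $A^{\rm c}_k$ consists of the rows $k+(j-1)s$,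 $j=1,\dots,N$, of $A^{\rm c}$. The collocation points are the grid points $\tilde x_i$ lying in $[-1,1]$; there are $M$ of them, ordered as in the permuted grid, and $s$ is large enough that $M>N$. The matrix $R\in\mathbb{R}^{M\times L}$ is the restriction operator selecting from the permuted rows those corresponding to the collocation points, $A=R\,\Pi A^{\rm c}$ (so $A$ has entries $\phi_j(x_i)$ at the collocation points $x_i$), and $E=R^\dagger\in\mathbb{R}^{L\times M}$ is the corresponding extension by zero-padding. The right-hand side is $b\in\mathbb{R}^M$ with $b_i=f(x_i)$ for the function $f$ being approximated. The unitary DFT matrix $F\in\mathbb{C}^{N\times N}$ is $F_{kl}=\frac{1}{\sqrt N}e^{2\pi \mathrm{i}(k-1)(l-1)/N}$, $P\in\mathbb{C}^{L\times L}$ is the block-diagonal matrix with $s$ copies of $F^*$ on its diagonal, $B=P\,\Pi A^{\rm c}F\in\mathbb{C}^{L\times N}$, and $B^\dagger$ is its pseudo-inverse. $\|\cdot\|$ is the Euclidean norm. AZ algorithm with matrices $A$, $Z$ and right-hand side $b$: (1) solve $(I-AZ^* )A\mathbf{x}_2=(I-AZ^* )b$, approximately in a least squares sense (an approximate solution $\mathbf{x}_2$ of small residual, not necessarily the exact minimizer, is admitted); (2) set $\mathbf{x}_1=Z^*(b-A\mathbf{x}_2)$; (3) set $\mathbf{x}=\mathbf{x}_1+\mathbf{x}_2$. ''A solution of the AZ algorithm'' is thus a vector of the form $\mathbf{x}=\mathbf{x}_2+Z^*(b-A\mathbf{x}_2)$ with $\mathbf{x}_2$ a solution of step (1) in this sense;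 note that the residual of step (1) at $\mathbf{x}_2$ equals $b-A\mathbf{x}$, so the bound on $\|A\mathbf{x}-b\|$ is at the same time the bound on the residual of step (1). *)

(* Defs.v *)
From mathcomp Require Import all_boot all_order all_algebra.
From mathcomp Require Import all_classical all_reals all_analysis.
From mathcomp Require Import perm complex mxtens.

Set Implicit Arguments.
Unset Strict Implicit.
Unset Printing Implicit Defensive.

Import Order.TTheory GRing.Theory Num.Theory.

Local Open Scope classical_set_scope.
Local Open Scope ring_scope.
Local Open Scope sesquilinear_scope.
Local Open Scope complex_scope.

Section PseudoInverse.
Context {C : numClosedFieldType}.

Definition penrose m n (A : 'M[C]_(m, n)) (X : 'M[C]_(n, m)) : Prop :=
  [/\ A *m X *m A = A, X *m A *m X = X,
      (A *m X) ^t* = A *m X & (X *m A) ^t* = X *m A].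

(* The default value 0 is never used, see [pinvP]. *)
Definition pinv m n (A : 'M[C]_(m, n)) : 'M[C]_(n, m) :=
  xget 0 [set X | penrose A X].

Lemma trmxCM m n p (A : 'M[C]_(m, n)) (B : 'M[C]_(n, p)) :
  (A *m B) ^t* = B ^t* *m A ^t*.
Proof. by rewrite trmx_mul map_mxM. Qed.

Lemma penrose_unique m n (A : 'M[C]_(m, n)) X Y :
  penrose A X -> penrose A Y -> X = Y.
Proof.
move=> [AXA XAX AX XA] [AYA YAY AY YA].
have E1 : A *m X = A *m Y.
  by rewrite -AX -{1}AYA -(mulmxA (A *m Y)) trmxCM AX AY mulmxA AXA.
have E2 : X *m A = Y *m A.
  by rewrite -XA -{1}AYA -(mulmxA A Y) mulmxA trmxCM XA YA -(mulmxA Y)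
             (mulmxA A X) AXA.
by rewrite -XAX E2 -mulmxA E1 mulmxA YAY.
Qed.

Lemma gram_unitmx r n (A : 'M[C]_(r, n)) :
  row_free A -> A *m A ^t* \in unitmx.
Proof.
move=> Af; rewrite -row_free_unit -kermx_eq0; apply/rowV0P => v /sub_kermxP.
rewrite mulmxA => vAA; apply: (row_free_inj Af); rewrite mul0mx.
have : (v *m A *m (v *m A) ^t*) 0 0 = 0.
  by rewrite trmxCM mulmxA vAA mul0mx mxE.
rewrite mxE => /eqP; rewrite psumr_eq0 => [/allP h|i _]; last first.
  by rewrite !mxE mul_conjC_ge0.
apply/rowP => i; apply/eqP; rewrite [in X in _ == X]mxE.
by have := h i (mem_index_enum i); rewrite !mxE /= mul_conjC_eq0.
Qed.

Lemma pinv_exists m n (A : 'M[C]_(m, n)) : exists X, penrose A X.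
Proof.
suff main r (U : 'M[C]_(m, r)) (V : 'M[C]_(r, n)) :
    row_full U -> row_free V -> exists X, penrose (U *m V) X.
  rewrite -(mulmx_base A); apply: main; first exact: col_base_full.
  exact: row_base_free.
move=> Uf Vf.
have Vu : V *m V ^t* \in unitmx by exact: gram_unitmx.
have Uu : U ^t* *m U \in unitmx.
  rewrite -[X in _ *m X]trmxCK; apply: gram_unitmx.
  by rewrite /row_free mxrank_map mxrank_tr.
have herm k (G : 'M[C]_k) : G ^t* = G -> (invmx G) ^t* = invmx G.
  by move=> GG; rewrite trmx_inv map_invmx GG.
have Vh : (invmx (V *m V ^t*)) ^t* = invmx (V *m V ^t*).
  by apply: herm; rewrite trmxCM trmxCK.
have Uh : (invmx (U ^t* *m U)) ^t* = invmx (U ^t* *m U).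
  by apply: herm; rewrite trmxCM trmxCK.
pose X := V ^t* *m invmx (V *m V ^t*) *m (invmx (U ^t* *m U) *m U ^t*).
have AX : U *m V *m X = U *m (invmx (U ^t* *m U) *m U ^t*).
  by rewrite /X -!mulmxA (mulmxA V) (mulKVmx Vu).
have XA : X *m (U *m V) = V ^t* *m (invmx (V *m V ^t*) *m V).
  by rewrite /X -!mulmxA (mulmxA (U ^t*)) (mulKmx Uu).
exists X; split.
- by rewrite AX -!mulmxA (mulmxA (U ^t*)) (mulKmx Uu).
- by rewrite XA /X -!mulmxA (mulmxA V) (mulKVmx Vu).
- by rewrite AX !trmxCM trmxCK Uh !mulmxA.
- by rewrite XA !trmxCM trmxCK Vh !mulmxA.
Qed.

Lemma pinvP m n (A : 'M[C]_(m, n)) : penrose A (pinv A).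
Proof. by have [X AX] := pinv_exists A; apply: (xgetPex 0); exists X. Qed.

Lemma pinvE m n (A : 'M[C]_(m, n)) X : penrose A X -> pinv A = X.
Proof. exact: penrose_unique (pinvP A). Qed.

End PseudoInverse.

Section Norms.
Context {R : realType}.

Definition enorm n (u : 'cV[R]_n) : R := Num.sqrt (\sum_i u i 0 ^+ 2).

Definition cnorm n (u : 'cV[R[i]]_n) : R :=
  Num.sqrt (\sum_i (complex.Re (u i 0) ^+ 2 + complex.Im (u i 0) ^+ 2)).

Definition mxC m n (A : 'M[R]_(m, n)) : 'M[R[i]]_(m, n) :=
  map_mx (real_complex R) A.

Lemma mxCM m n p (A : 'M[R]_(m, n)) (B : 'M[R]_(n, p)) :
  mxC (A *m B) = mxC A *m mxC B.
Proof. exact: map_mxM. Qed.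

Lemma cnorm_mxC n (u : 'cV[R]_n) : cnorm (mxC u) = enorm u.
Proof.
by congr (Num.sqrt _); apply: eq_bigr => i _; rewrite mxE /= expr0n /= addr0.
Qed.

End Norms.

(* [Zs] stands for Z^*.  Step (1) is solved approximately: [tol] bounds the
   residual of (I - A Z^* ) A x2 = (I - A Z^* ) b at [x2]. *)
Definition AZ_solution (R : realType) m n (A : 'M[R[i]]_(m, n))
    (Zs : 'M[R[i]]_(n, m)) (b : 'cV[R[i]]_m) (tol : R)
    (x2 x : 'cV[R[i]]_n) : Prop :=
  let IAZ := 1%:M - A *m Zs in
  cnorm (IAZ *m b - IAZ *m A *m x2) <= tol /\
  exists2 x1, x1 = Zs *m (b - A *m x2) & x = x1 + x2.

Section RBF.
Context {R : realType}.
Variables (T : R) (N s : nat).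

Definition gaussian (eps r : R) : R := expR (- (eps ^+ 2 * r ^+ 2)).

(* The terms are positive, so the sum over the integers is an [esum]. *)
Definition gaussian_per (eps x : R) : R :=
  fine (\esum_(m in [set: int]) (gaussian eps (x - 2 * m%:~R * T))%:E).

Definition shape_param (tau0 : R) : R :=
  pi / (2 * T * Num.sqrt (2 * ln (1 + tau0 ^- 2))) * N%:R.

(* All indices start at 0. *)
Definition center (j : 'I_N) : R := - T + j%:R * (2 * T / N%:R).

Definition grid (i : nat) : R := - T + i%:R * (2 * T / (s * N)%:R).

Definition Ac (eps : R) : 'M[R]_(s * N, N) :=
  \matrix_(i, j) gaussian_per eps (grid i - center j).

(* Row k * N + j of the permuted system (0 <= k < s, 0 <= j < N), that is row j
   of block k, is row k + j * s of the original one. *)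
Definition unpermuted (p : 'I_(s * N)) : nat := (p %/ N + p %% N * s)%N.

Definition Pi : 'M[R]_(s * N) := \matrix_(p, i) (unpermuted p == i)%:R.

Definition collocated : pred 'I_(s * N) :=
  [pred p | - 1 <= grid (unpermuted p) <= 1].

Definition ncolloc : nat := #|collocated|.

Definition colloc_point (i : 'I_ncolloc) : R :=
  grid (unpermuted (enum_val i)).

Definition restriction : 'M[R]_(ncolloc, s * N) :=
  \matrix_(i, p) (enum_val i == p)%:R.

Definition extension : 'M[R[i]]_(s * N, ncolloc) := pinv (mxC restriction).

Definition collocation_mx (eps : R) : 'M[R]_(ncolloc, N) :=
  restriction *m Pi *m Ac eps.

Definition rhs (f : R -> R) : 'cV[R]_ncolloc := \col_i f (colloc_point i).

Definition cis (t : R) : R[i] := cos t +i* sin t.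

Definition DFT : 'M[R[i]]_N :=
  \matrix_(k, l) (((Num.sqrt N%:R)^-1)%:C * cis (2 * pi * (k * l)%:R / N%:R)).

(* Kronecker product with the identity: block diagonal, s copies of F^*. *)
Definition blockDFT : 'M[R[i]]_(s * N) := 1%:M *t DFT ^t*.

Definition Bmx (eps : R) : 'M[R[i]]_(s * N, N) :=
  blockDFT *m mxC (Pi *m Ac eps) *m DFT.

Definition Zstar (eps : R) : 'M[R[i]]_(N, ncolloc) :=
  DFT *m pinv (Bmx eps) *m blockDFT *m extension.

Lemma unpermuted_lt p : (unpermuted p < s * N)%N.
Proof.
have [k j] := mxtens_indexP p; rewrite /unpermuted /=.
have N0 : (0 < N)%N by exact: leq_ltn_trans (ltn_ord j).
rewrite divnMDl// divn_small// addn0 modnMDl modn_small//.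
apply: (@leq_trans (j.+1 * s)); first by rewrite mulSn ltn_add2r.
by rewrite mulnC leq_mul2l ltn_ord orbT.
Qed.

Lemma unpermuted_inj : injective unpermuted.
Proof.
move=> p q; have [k j] := mxtens_indexP p; have [k' j'] := mxtens_indexP q.
rewrite /unpermuted /=.
have N0 : (0 < N)%N by exact: leq_ltn_trans (ltn_ord j).
have s0 : (0 < s)%N by exact: leq_ltn_trans (ltn_ord k).
rewrite !divnMDl// !divn_small// !addn0 !modnMDl !modn_small// => e.
have ek : k = k' :> nat.
  by move/(congr1 (modn^~ s)): e; rewrite ![(_ + _ * s)%N]addnC !modnMDl
    !modn_small.
have ej : j = j' :> nat.
  by move/(congr1 (divn^~ s)): e; rewrite ![(_ + _ * s)%N]addnC !divnMDl//
    !divn_small// !addn0.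
by apply: val_inj; rewrite /= ek ej.
Qed.

Lemma Pi_is_perm_mx : is_perm_mx Pi.
Proof.
pose h p := Ordinal (unpermuted_lt p).
have hI : injective h.
  by move=> p q /(congr1 val); exact: unpermuted_inj.
apply/is_perm_mxP; exists (perm hI); apply/matrixP => p i.
by rewrite !mxE permE.
Qed.

Lemma collocation_mxE eps i j :
  collocation_mx eps i j = gaussian_per eps (colloc_point i - center j).
Proof.
rewrite /collocation_mx -mulmxA mxE (bigD1 (enum_val i))//= big1 => [|p pi].
  rewrite addr0 mxE eqxx mul1r mxE (bigD1 (Ordinal (unpermuted_lt (enum_val i))))//=.
  rewrite big1 => [|q qi]; first by rewrite addr0 !mxE eqxx mul1r.
  rewrite mxE eq_sym; move: qi; rewrite -val_eqE /= => /negPf ->.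
  by rewrite mul0r.
by rewrite mxE eq_sym (negPf pi) mul0r.
Qed.

Lemma extensionE : extension = mxC restriction^T.
Proof.
apply: pinvE.
have RE : restriction *m restriction^T = 1%:M.
  apply/matrixP => i j; rewrite mxE (bigD1 (enum_val i))//= big1 => [|p pi].
    by rewrite !mxE eqxx mul1r addr0 (inj_eq enum_val_inj) eq_sym.
  by rewrite !mxE eq_sym (negPf pi) mul0r.
have conjE m n (M : 'M[R]_(m, n)) : (mxC M) ^t* = mxC M^T.
  apply/matrixP => i j; rewrite !mxE; apply/CrealP; rewrite complex_real//.
by split; rewrite -?mxCM ?conjE -?mxCM ?RE ?mul1mx -?mulmxA ?RE ?mulmx1
  ?trmx_mul ?trmxK ?trmx1.
Qed.

End RBF.

(* Main.v *)
Require Import Defs.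
From mathcomp Require Import all_boot all_order all_algebra.
From mathcomp Require Import all_classical all_reals all_analysis.
From mathcomp Require Import complex mxtens.
From mathcomp Require Import ring lra zify.

(* With x2 an admissible least squares solution, r = b - A x2 and Q = Pi Ac, the
   unitarity of the Fourier matrices turns Z^* into Q^+ R^T, so that b - A x =
   R (I - Q Q^+) R^T r is no longer than r, and x - x2 = Q^+ R^T r is bounded by
   |r| over the smallest singular value of Q.  That value is bounded below by its
   analogue for the first block, the circulant matrix sum_i q^(i^2) S^i with S
   the cyclic shift, q = e^(-a) and a = pi^2 / (2 log (1 + tau^-2)).  By the
   Jacobi triple product the latter factors into terms I + q^(2k+1) S^(+-1), which
   shrink a vector at most by 1 - q^(2k+1), so that it shrinks a vector at most by
   prod_n (1 - q^n) / (1 + q^n) >= e^(-pi^2 / (4 a)) = (1 + tau^-2)^(-1/2). *)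

Set Implicit Arguments.
Unset Strict Implicit.
Unset Printing Implicit Defensive.

Import Order.TTheory GRing.Theory Num.Theory.
Import numFieldNormedType.Exports.
Local Open Scope ring_scope.

(** * The finite Jacobi triple product *)

(** The q-Pochhammer symbol (p; p)_n. *)
Definition qfac (F : fieldType) (p : F) (n : nat) : F :=
  \prod_(k < n) (1 - p ^+ k.+1).

Lemma qfacS (F : fieldType) (p : F) n : qfac p n.+1 = qfac p n * (1 - p ^+ n.+1).
Proof. by rewrite /qfac big_ord_recr. Qed.

Lemma qfac_neq0 (F : fieldType) (p : F) n :
  (forall k, p ^+ k.+1 != 1) -> qfac p n != 0.
Proof.
by move=> hp; apply/prodf_neq0 => k _; rewrite subr_eq0 eq_sym.
Qed.

(* The q-binomial coefficients are kept divided by the constant [qfac p n]. *)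
Lemma qbinomial (F : fieldType) (A : comAlgType F) (p : F) (x y : A) n :
  (forall k, p ^+ k.+1 != 1) ->
  \sum_(i < n.+1) (p ^+ 'C(i, 2) / (qfac p i * qfac p (n - i)))
                    *: (x ^+ i * y ^+ (n - i))
  = (qfac p n)^-1 *: \prod_(k < n) (y + p ^+ k *: x).
Proof.
move=> hp; elim: n => [|n IHn].
  rewrite big_ord_recl !big_ord0 addr0 /qfac !big_ord0 !mulr1 divr1. by rewrite invr1.
have W0 k := qfac_neq0 k hp.
have P0 k : 1 - p ^+ k.+1 != 0 by rewrite subr_eq0 eq_sym.
rewrite [X in _ = _ *: X]big_ord_recr/= qfacS invfM.
rewrite [X in _ = X *: _]mulrC -scalerA scalerAl -IHn.
apply: (scalerI (P0 n)); rewrite scalerA divff// scale1r mulrDr scaler_sumr.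
pose u i := (p ^+ 'C(i, 2) / (qfac p i * qfac p (n - i))) *: (x ^+ i * y ^+ (n.+1 - i)).
pose v i := (p ^+ 'C(i, 2) * p ^+ n / (qfac p i * qfac p (n - i))) *: (x ^+ i.+1 * y ^+ (n - i)).
(* [u] and [v] come from the terms [y] and [p ^+ n *: x] of the new factor. Their coefficients
   recombine by the Pascal rule 1 - p^(n+1) = (1 - p^(n-i)) + p^(n-i) (1 - p^(i+1)). *)
transitivity (\sum_(i < n.+1) u i + \sum_(i < n.+1) v i).
  rewrite big_ord_recl [in RHS]big_ord_recl/= [X in _ + X = _]big_ord_recr/=.
  rewrite [in X in _ = _ + X]big_ord_recr/=.
  rewrite !addrA; congr (_ + _); last first.
    rewrite /v !subnn scalerA /bump /= !add1n qfacS binS bin1 exprD.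
    by congr (_ *: _); field; rewrite !W0 P0.
  rewrite -addrA -big_split/=; congr (_ + _).
    rewrite /u scalerA !subn0 qfacS [qfac p 0]big_ord0; congr (_ *: _).
    by field; rewrite !W0 P0.
  apply: eq_bigr => i _; rewrite /u /v /bump /= !add1n !subSS.
  rewrite scalerA -scalerDl; congr (_ *: _).
  have -> : (n - i = (n - i.+1).+1)%N by rewrite -subSn// subSS.
  rewrite !qfacS binS bin1 exprD.
  have -> : p ^+ n.+1 = p ^+ i.+1 * p ^+ (n - i.+1).+1.
    by rewrite -exprD; congr (_ ^+ _); have := ltn_ord i; lia.
  have -> : p ^+ n = p ^+ i * p ^+ (n - i.+1).+1.
    by rewrite -exprD; congr (_ ^+ _); have := ltn_ord i; lia.
  by field; rewrite !W0 !P0.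
congr (_ + _).
  rewrite mulr_suml; apply: eq_bigr => i _; rewrite /u -scalerAl -mulrA.
  by rewrite -exprSr subSn// -ltnS.
rewrite mulr_suml; apply: eq_bigr => i _.
by rewrite /v -scalerAl -scalerAr scalerA; congr (_ *: _); rewrite ?exprS; ring.
Qed.

(** Completing the square: the left side is i^2 + 2m (2m - i), the exponent of q that [qbinomial]
    yields at p = q^2, x = q X, y = q^(2m). *)
Lemma distn_exponent i m : (i <= m.*2)%N ->
  (2 * 'C(i, 2) + i + m.*2 * (m.*2 - i) = `|i%:Z - m%:Z| ^ 2 + 3 * m ^ 2)%N.
Proof.
move=> im; have e : (2 * 'C(i, 2) = i * i.-1)%N.
  rewrite bin2 mulnC muln2 -[RHS]odd_double_half.
  by case: i {im} => // i; rewrite oddM /= andNb.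
rewrite e; case: i im {e} => [|i] im /=; first lia.
have [?|?] := leqP m i.+1.
  have -> : `|i.+1%:Z - m%:Z|%N = (i.+1 - m)%N by lia.
  by rewrite -!muln2; nia.
have -> : `|i.+1%:Z - m%:Z|%N = (m - i.+1)%N by lia.
by rewrite -!muln2; nia.
Qed.

Lemma prodX_odd (F : fieldType) (q : F) m :
  \prod_(k < m) q ^+ k.*2.+1 = q ^+ (m ^ 2).
Proof.
elim: m => [|m IHm]; first by rewrite big_ord0.
rewrite big_ord_recr/= IHm -exprD; congr (_ ^+ _); rewrite -muln2; nia.
Qed.

(* Take x = q 'X and y = q^(2m) in [qbinomial]. *)
Lemma finite_jacobi_triple (F : fieldType) (q : F) m :
  q != 0 -> (forall k, q ^+ k.+1 != 1) ->
  \sum_(i < m.*2.+1) (q ^+ (`|i%:Z - m%:Z| ^ 2)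
      / (qfac (q ^+ 2) i * qfac (q ^+ 2) (m.*2 - i))) *: 'X^i
  = (qfac (q ^+ 2) m.*2)^-1 *:
    \prod_(k < m) ((1 + q ^+ k.*2.+1 *: 'X) * ('X + (q ^+ k.*2.+1)%:P)).
Proof.
move=> q0 q1.
have p1 k : (q ^+ 2) ^+ k.+1 != 1 by rewrite -exprM mulnS; exact: q1.
have q3 : q ^+ (3 * m ^ 2) != 0 by exact: expf_neq0.
apply: (scalerI q3); rewrite scaler_sumr.
transitivity (\sum_(i < m.*2.+1) ((q ^+ 2) ^+ 'C(i, 2)
    / (qfac (q ^+ 2) i * qfac (q ^+ 2) (m.*2 - i)))
    *: ((q *: 'X) ^+ i * ((q ^+ m.*2)%:P) ^+ (m.*2 - i) : {poly F})).
  apply: eq_bigr => i _.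
  rewrite -polyC_exp [X in _ = _ *: X]mulrC mul_polyC exprZn !scalerA; congr (_ *: _).
  rewrite mulrA -exprD addnC -distn_exponent; last by rewrite -ltnS.
  by rewrite !(exprD q _ (m.*2 * _)) exprD -!exprM; ring.
rewrite qbinomial// scalerA [in RHS]mulrC -scalerA; congr (_ *: _).
(* The 2m factors are q^(2m) + q^(2k+1) X. The upper half k = m + k' gives up q^(2m) and leaves 1 +
   q^(2k'+1) X; the lower half, reversed, gives up q^(2u+1) with u = m - k' - 1 and leaves X +
   q^(2k'+1). The extracted powers multiply to q^(3 m^2), the surplus of the completed square. *)
rewrite -addnn big_split_ord/= (reindex_inj rev_ord_inj)/= -big_split/=.
have -> : (3 * m ^ 2 = m ^ 2 + m.*2 * m)%N by rewrite -muln2; nia.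
rewrite (exprD q (m ^ 2)).
have -> : q ^+ (m ^ 2) = \prod_(k < m) q ^+ (m - k.+1).*2.+1.
  by rewrite -prodX_odd (reindex_inj rev_ord_inj).
have -> : q ^+ (m.*2 * m) = \prod_(k < m) q ^+ m.*2.
  by rewrite prodr_const card_ord exprM.
rewrite -big_split/=.
rewrite -scaler_prod; apply: eq_bigr => k _; rewrite -!exprM.
rewrite addnn.
set u := (_ - _)%N.
have -> : q ^+ m.*2 = q ^+ u.*2.+1 * q ^+ k.*2.+1.
  by rewrite -exprD; congr (_ ^+ _); have := ltn_ord k; rewrite /u; lia.
have -> : q ^+ (2 * (m + k)) = q ^+ m.*2 * q ^+ (2 * k).
  by rewrite -exprD; congr (_ ^+ _); lia.
have -> : q ^+ m.*2 = q ^+ u.*2.+1 * q ^+ k.*2.+1.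
  by rewrite -exprD; congr (_ ^+ _); have := ltn_ord k; rewrite /u; lia.
rewrite !exprS -!muln2 ![(2 * _)%N]mulnC -!mul_polyC !rmorphM/=.
by ring.
Qed.

(** * The theta product *)

Lemma le_sin (R : realType) (x : R) : 0 <= x -> sin x <= x.
Proof.
rewrite le_eqVlt => /predU1P[<-|x0]; first by rewrite sin0.
have dsin (t : R) : t \in `]0, x[%R -> is_derive t 1 (@sin R) (cos t).
  by move=> _; exact: is_derive_sin.
have csin : {within `[0, x], continuous (@sin R)}%classic.
  by apply: continuous_subspaceT => t; exact: continuous_sin.
have [t _] := MVT x0 dsin csin; rewrite sin0 !subr0 => ->.
by rewrite ler_piMl ?cos_le1// ltW.
Qed.

(* Iterating 1/sin^2 x = (1/sin^2 (x/2) + 1/cos^2 (x/2)) / 4 from x = pi/4. *)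
Lemma sum_csc2 (R : realType) n :
  \sum_(k < 2 ^ n) sin (k.*2.+1%:R * pi / 2 ^+ n.+2 : R) ^- 2 = 2 * 4 ^+ n.
Proof.
have half (y : R) : 0 < y < pi / 2 ->
    sin (y / 2) ^- 2 + sin (pi / 2 - y / 2) ^- 2 = 4 * sin y ^- 2.
  move=> /andP[y0 ypi].
  have -> : sin (pi / 2 - y / 2) = cos (y / 2).
    by rewrite sinB sin_pihalf cos_pihalf mul0r mul1r subr0.
  have -> : sin y = 2 * (sin (y / 2) * cos (y / 2)).
    have {1}-> : y = y / 2 *+ 2 by rewrite -mulr_natr divfK.
    by rewrite sin_mulr2n -mulr_natl [cos _ * _]mulrC.
  have s0 : sin (y / 2) != 0.
    by rewrite gt_eqF// sin_gt0_pihalf//; apply/andP; split; lra.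
  have c0 : cos (y / 2) != 0.
    by rewrite gt_eqF// cos_gt0_pihalf//; apply/andP; split; lra.
  have := cos2Dsin2 (y / 2).
  set s := sin _ in s0 *; set c := cos _ in c0 * => sc.
  have -> : s ^- 2 + c ^- 2 = (c ^+ 2 + s ^+ 2) / (s ^+ 2 * c ^+ 2).
    by field; rewrite s0 c0.
  by rewrite sc; field; rewrite s0 c0.
elim: n => [|n IHn].
  rewrite expn0 big_ord_recl big_ord0 addr0 /= mul1r expr0 mulr1.
  have -> : (pi / 2 ^+ 2 = pi / 2 / 2 :> R) by rewrite expr2 invfM mulrA.
  have := cos2Dsin2 (pi / 2 / 2 : R).
  have -> : cos (pi / 2 / 2 : R) = sin (pi / 2 / 2).
    have {1}-> : (pi / 2 / 2 = pi / 2 - pi / 2 / 2 :> R) by lra.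
    by rewrite cosB sin_pihalf cos_pihalf mul0r mul1r add0r.
  set t := sin _ ^+ 2 => tt; have -> : t = 2^-1 by lra.
  by rewrite invrK.
rewrite (_ : 2 * _ = 4 * (2 * 4 ^+ n)); last by rewrite exprS; ring.
(* The terms k and 2^(n+1) - 1 - k are paired: their angles add up to pi / 2. *)
rewrite -IHn expnS mul2n -addnn big_split_ord/=.
rewrite [X in _ + X](reindex_inj rev_ord_inj)/= -big_split/= mulr_sumr.
apply: eq_bigr => k _; set y := _ / 2 ^+ n.+2.
have p0 : (2 : R) ^+ n.+2 != 0 by rewrite expf_neq0.
have k2n : k.*2.+1%:R < 2 ^+ n.+1 :> R.
  by rewrite -natrX ltr_nat expnS; have := ltn_ord k; lia.
have pp := @pi_gt0 R; have pn0 : pi != 0 :> R by rewrite gt_eqF.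
rewrite -half.
  congr (sin _ ^- 2 + sin _ ^- 2); rewrite /y.
    by rewrite [2 ^+ n.+3]exprS; field.
  have -> : (2 ^ n + (2 ^ n - k.+1)).*2.+1%:R = 2 ^+ n.+2 - k.*2.+1%:R :> R.
    rewrite -natrX -natrB; last first.
      by rewrite !expnS; have := ltn_ord k; lia.
    by congr (_%:R); rewrite !expnS; have := ltn_ord k; lia.
  by rewrite [2 ^+ n.+3]exprS; field.
apply/andP; split; first by rewrite /y !mulr_gt0// invr_gt0 exprn_gt0.
have := k2n; rewrite -(ltr_pM2r pp) /y ltr_pdivrMr ?exprn_gt0// [2 ^+ n.+2]exprS.
by move: (_ ^+ _) (_%:R) => u v; lra.
Qed.

(** Since sin y <= y, the terms y^(-2) at y = (2k+1) pi / 2^(n+2) are dominated by those of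
    [sum_csc2], which gives the sharp constant at every finite stage. *)
Lemma sum_inv_odd_sqr_le (R : realType) n :
  \sum_(k < n) (k.*2.+1%:R : R) ^- 2 <= pi ^+ 2 / 8.
Proof.
have n2n : (n <= 2 ^ n)%N by rewrite ltnW// ltn_expl.
apply: (@le_trans _ _ (\sum_(k < 2 ^ n) (k.*2.+1%:R : R) ^- 2)).
  rewrite (big_ord_widen _ (fun k => (k.*2.+1%:R : R) ^- 2) n2n).
  rewrite big_mkcond/=; apply: ler_sum => k _; by case: ifP.
have pp := @pi_gt0 R; have pn0 : pi != 0 :> R by rewrite gt_eqF.
have p2 : (4 : R) ^+ n.+2 = (2 ^+ n.+2) ^+ 2 by rewrite -exprM mulnC exprM; congr (_ ^+ _); rewrite expr2 -natrM.
have p0 : (2 : R) ^+ n.+2 != 0 by rewrite expf_neq0.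
have c0 : 0 < (4 : R) ^+ n.+2 / pi ^+ 2 by rewrite divr_gt0// exprn_gt0.
rewrite -(ler_pM2l c0) mulr_sumr.
have -> : 4 ^+ n.+2 / pi ^+ 2 * (pi ^+ 2 / 8) = 2 * 4 ^+ n :> R.
  rewrite (_ : 4 ^+ n.+2 = 16 * 4 ^+ n); last by rewrite !exprS; ring.
  by move: (pi) pn0 => c c1; field.
rewrite -(sum_csc2 R n); apply: ler_sum => k _.
set y := _ * pi / _.
have y0 : 0 < y by rewrite /y !mulr_gt0// invr_gt0 exprn_gt0.
have -> : 4 ^+ n.+2 / pi ^+ 2 * k.*2.+1%:R ^- 2 = y ^- 2.
  rewrite p2 /y; have : k.*2.+1%:R != 0 :> R by rewrite pnatr_eq0.
  by move: (_%:R) (pi) pn0 (_ ^+ n.+2) p0 => u c c1 d d0 u0; field; rewrite d0 u0 c1.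
have yp : y < pi.
  have : k.*2.+1%:R < 2 ^+ n.+2 :> R.
    by rewrite -natrX ltr_nat !expnS; have := ltn_ord k; lia.
  by rewrite -(ltr_pM2r pp) /y ltr_pdivrMr ?exprn_gt0// [pi * _]mulrC.
have s0 : 0 < sin y by rewrite sin_gt0_pi// y0.
rewrite lef_pV2 ?posrE ?exprn_gt0//; apply: lerXn2r; rewrite ?nnegrE ?(ltW s0) ?(ltW y0)//.
by rewrite le_sin ?ltW.
Qed.

Section Limits.
Local Open Scope classical_set_scope.

Lemma is_derive_artanh_sum (R : realType) L (t : R) :
  is_derive t 1 (fun t : R => \sum_(l < L) t ^+ l.*2.+1 / l.*2.+1%:R)
    (\sum_(l < L) t ^+ l.*2).
Proof.
pose p : {poly R} := \sum_(l < L) l.*2.+1%:R^-1 *: 'X^(l.*2.+1).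
have -> : (fun t : R => \sum_(l < L) t ^+ l.*2.+1 / l.*2.+1%:R) = horner p.
  apply/funext => u; rewrite horner_sum; apply: eq_bigr => l _.
  by rewrite hornerZ hornerXn mulrC.
have -> : \sum_(l < L) t ^+ l.*2 = p^`().[t]; last exact: is_derive_poly.
rewrite raddf_sum horner_sum; apply: eq_bigr => l _.
by rewrite /= derivZ derivXn hornerZ hornerMn hornerXn -(mulr_natl (t ^+ _)) mulKf ?pnatr_eq0.
Qed.

(** The left side minus the truncated series has derivative 2 t^(2L) / (1 - t^2), a geometric tail;
    the mean value theorem on [0, x] does the rest. *)
Lemma ln_artanh_le (R : realType) (x : R) L : 0 <= x < 1 ->
  ln (1 + x) - ln (1 - x) <=
  2 * \sum_(l < L) x ^+ l.*2.+1 / l.*2.+1%:R + 2 * x ^+ L.*2.+1 / (1 - x ^+ 2).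
Proof.
move=> /andP[]; rewrite le_eqVlt => /predU1P[<- _|x0 x1].
  rewrite addr0 subr0 subrr exprS !mul0r mulr0 mul0r addr0.
  by rewrite mulr_ge0// sumr_ge0// => l _; rewrite exprS !mul0r.
pose s t : R := \sum_(l < L) t ^+ l.*2.+1 / l.*2.+1%:R.
pose g (t : R) : R := ln (1 + t) - ln (1 - t) - 2 *: s t.
pose dg (t : R) : R := (1 + t)^-1 + (1 - t)^-1 - 2 *: \sum_(l < L) t ^+ l.*2.
have gE (t : R) : - 1 < t < 1 -> is_derive t 1 g (dg t).
  move=> /andP[tN1 t1].
  have d1 : is_derive t 1 (fun t : R => 1 + t) 1.
    by rewrite -[X in is_derive _ _ _ X]add0r; apply: is_deriveD.
  have d2 : is_derive t 1 (fun t : R => 1 - t) (- 1).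
    by rewrite -[X in is_derive _ _ _ X]add0r; apply: is_deriveB.
  have l1 : is_derive (1 + t) 1 (@ln R) (1 + t)^-1 by apply: is_derive1_ln; lra.
  have l2 : is_derive (1 - t) 1 (@ln R) (1 - t)^-1 by apply: is_derive1_ln; lra.
  have D := is_deriveB (is_deriveB (@is_derive1_comp _ (@ln R) (fun t => 1 + t) t _ _ l1 d1)
    (@is_derive1_comp _ (@ln R) (fun t => 1 - t) t _ _ l2 d2))
    (is_deriveZ 2 (is_derive_artanh_sum L t)).
  apply: (is_derive_eq D); rewrite /dg mulr1 mulrN1 opprK.
  by [].
have dE (t : R) : 0 < t < 1 -> dg t = 2 * t ^+ L.*2 / (1 - t ^+ 2).
  move=> /andP[t0 t1].
  have u : 1 - t ^+ 2 != 0 by rewrite gt_eqF// subr_gt0 expr_lt1 ?ltW.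
  have e : (1 - t ^+ 2) * \sum_(l < L) t ^+ l.*2 = 1 - t ^+ L.*2.
    apply: oppr_inj; rewrite -mulNr !opprB -mul2n exprM [in RHS]subrX1.
    by congr (_ * _); apply: eq_bigr => l _; rewrite -mul2n exprM.
  rewrite /dg; have -> : \sum_(l < L) t ^+ l.*2 = (1 - t ^+ L.*2) / (1 - t ^+ 2).
    by rewrite -e mulrAC divff// mul1r.
  by rewrite [_ *: _]mulrA; field; rewrite u; apply/andP; split; lra.
have cg : {within `[0, x], continuous g}%classic.
  apply: continuous_in_subspaceT => t; rewrite inE/= in_itv/= => /andP[t0 tx].
  apply: differentiable_continuous; apply/derivable1_diffP.
  by apply: ex_derive; apply: gE; apply/andP; split; lra.
have gE0 (t : R) : t \in `]0, x[%R -> is_derive t 1 g (dg t).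
  by rewrite in_itv/= => /andP[t0 tx]; apply: gE; apply/andP; split; lra.
have [t] := MVT x0 gE0 cg.
rewrite in_itv/= => /andP[t0 tx]; rewrite dE; last by rewrite t0 (lt_trans tx).
have -> : g 0 = 0.
  rewrite /g addr0 subr0 subrr sub0r /s big1 ?scaler0 ?oppr0// => l _.
  by rewrite exprS !mul0r.
rewrite !subr0 => E; rewrite -lerBlDl; have -> : ln (1 + x) - ln (1 - x) -
  2 * \sum_(l < L) x ^+ l.*2.+1 / l.*2.+1%:R = g x by [].
rewrite E [x ^+ L.*2.+1]exprSr [2 * (_ * x)]mulrA [leRHS]mulrAC ler_pM2r//.
have le_tx n : t ^+ n <= x ^+ n by apply: lerXn2r; rewrite ?nnegrE ltW.
rewrite ler_pM//.
- by rewrite mulr_ge0// exprn_ge0// ltW.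
- by rewrite invr_ge0 subr_ge0 expr_le1 ?ltW// (lt_trans tx).
- by rewrite ler_pM2l.
- have t1 := lt_trans tx x1.
  by rewrite lef_pV2 ?posrE ?subr_gt0 ?expr_lt1 ?(ltW x0) ?(ltW t0)// lerB.
Qed.

(** The full series sums to 1 / (e^b - 1), and 1 + b <= e^b. *)
Lemma sum_geometric_expR_le (R : realType) (b : R) M : 0 < b ->
  \sum_(n < M) expR (- b) ^+ n.+1 <= b^-1.
Proof.
move=> b0; set y := expR _.
have y0 : 0 < y by exact: expR_gt0.
have y1 : y < 1 by rewrite expR_lt1 oppr_lt0.
have yb : b * y <= 1 - y.
  have : y * (1 + b) <= y * expR b by rewrite ler_pM2l// expR_ge1Dx.
  by rewrite /y expRN mulVf ?expR_eq0//; lra.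
rewrite -(ler_pM2l b0) divff ?gt_eqF//.
under eq_bigr do rewrite exprS; rewrite -mulr_sumr mulrA.
apply: (@le_trans _ _ ((1 - y) * \sum_(n < M) y ^+ n)).
  by rewrite ler_wpM2r// sumr_ge0// => i _; rewrite exprn_ge0// ltW.
rewrite -opprB mulNr -subrX1 opprB gerBl exprn_ge0//; exact: ltW.
Qed.

Lemma le_of_le_add_geometric (R : realType) (u v K z : R) : 0 <= z < 1 ->
  (forall L : nat, u <= v + K * z ^+ L) -> u <= v.
Proof.
move=> /andP[z0 z1] h.
have z1' : `|z| < 1 by rewrite ger0_norm.
have c : (v + K * z ^+ L)%R @[L --> \oo] --> v + 0.
  apply: cvgD; first exact: cvg_cst.
  exact: cvg_geometric.
rewrite -[v]addr0; apply: (ler_cvg_to (cvg_cst u) c).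
by near=> L; exact: h.
Unshelve. all: by end_near.
Qed.

(* ln ((1 + x) / (1 - x)) = 2 sum_l x^(2l+1) / (2l+1) at x = e^(-a(n+1)); summing
   over n first leaves at most (2 / a) sum_l (2l+1)^(-2). *)
Lemma sum_artanh_expR_le (R : realType) (a : R) M : 0 < a ->
  \sum_(n < M) (ln (1 + expR (- a) ^+ n.+1) - ln (1 - expR (- a) ^+ n.+1))
  <= pi ^+ 2 / (4 * a).
Proof.
move=> a0; set q := expR _.
have q0 : 0 < q by exact: expR_gt0.
have q1 : q < 1 by rewrite expR_lt1 oppr_lt0.
have q2 : 0 < 1 - q ^+ 2 by rewrite subr_gt0 expr_lt1// ltW.
(* The remainder in [ln_artanh_le] is at most 2 q^L / (1 - q^2) for each of the M values of n, so it
   vanishes as L grows. *)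
apply: (@le_of_le_add_geometric _ _ _ (M%:R * (2 / (1 - q ^+ 2))) q).
  by rewrite q1 ltW.
move=> L.
have qn n : 0 <= q ^+ n.+1 <= q.
  have q0' := ltW q0; have q1' := ltW q1.
  by rewrite exprn_ge0//= exprS ler_piMr// exprn_ile1.
apply: (@le_trans _ _ (\sum_(n < M) (2 * (\sum_(l < L) q ^+ n.+1 ^+ l.*2.+1 / l.*2.+1%:R)
   + 2 / (1 - q ^+ 2) * q ^+ L))).
  apply: ler_sum => n _; have /andP[x0 xq] := qn n.
  apply: (le_trans (ln_artanh_le L _)); first by rewrite x0 (le_lt_trans xq).
  rewrite lerD2l -!mulrA ler_pM2l// [leRHS]mulrC; move: (q ^+ n.+1) x0 xq => x x0 xq.
  have xe n' : x ^+ n' <= q ^+ n' by apply: lerXn2r; rewrite ?nnegrE // ltW.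
  rewrite ler_pM// ?exprn_ge0 ?invr_ge0//.
  - by rewrite subr_ge0 (le_trans (xe _))// exprn_ile1 ?(ltW q0) ?(ltW q1).
  - by rewrite (le_trans (xe _))// -addnn -addSn exprD ler_piMl ?exprn_ge0 ?exprn_ile1 ?(ltW q0) ?(ltW q1)//.
  - by rewrite lef_pV2 ?posrE// ?lerB// (lt_le_trans q2)// lerB.
rewrite big_split/= sumr_const card_ord -[X in _ + X <= _]mulr_natl.
rewrite [X in _ + X <= _]mulrA lerD2r -mulr_sumr exchange_big/=.
have -> : pi ^+ 2 / (4 * a) = 2 * (a^-1 * (pi ^+ 2 / 8)).
  by move: (pi) => c; field; rewrite gt_eqF.
have aV : 0 <= a^-1 by rewrite invr_ge0 ltW.
rewrite ler_pM2l//; apply: le_trans (ler_wpM2l aV (sum_inv_odd_sqr_le _ L)).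
rewrite mulr_sumr; apply: ler_sum => l _.
rewrite -mulr_suml expr2 invfM mulrA ler_pM2r ?invr_gt0 ?ltr0n//.
have b0 : 0 < a * l.*2.+1%:R by rewrite mulr_gt0 ?ltr0n.
rewrite -invfM; apply: le_trans (sum_geometric_expR_le M b0).
rewrite le_eqVlt; apply/orP; left; apply/eqP; apply: eq_bigr => n _.
by rewrite -mulNr expRM_natr -!exprM mulnC.
Qed.

Lemma prod_theta_ge (R : realType) (a : R) M : 0 < a ->
  expR (- (pi ^+ 2 / (4 * a))) <=
  \prod_(n < M) ((1 - expR (- a) ^+ n.+1) / (1 + expR (- a) ^+ n.+1)).
Proof.
move=> a0.
have -> : \prod_(n < M) ((1 - expR (- a) ^+ n.+1) / (1 + expR (- a) ^+ n.+1)) =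
    expR (- \sum_(n < M) (ln (1 + expR (- a) ^+ n.+1) - ln (1 - expR (- a) ^+ n.+1))).
  rewrite -sumrN expR_sum; apply: eq_bigr => n _.
  have q1 : expR (- a) ^+ n.+1 < 1.
    by rewrite exprn_ilt1// ?expR_ge0// expR_lt1 oppr_lt0.
  have q0 : 0 < expR (- a) ^+ n.+1 by rewrite exprn_gt0 ?expR_gt0.
  by rewrite opprB expRB !lnK// posrE; lra.
by rewrite ler_expR lerN2 sum_artanh_expR_le.
Qed.

(** * Circulant theta matrices *)

Definition sqn (R : pzRingType) n (v : 'cV[R]_n) : R := \sum_i v i 0 ^+ 2.

Lemma sqn_ge0 (R : realDomainType) n (v : 'cV[R]_n) : 0 <= sqn v.
Proof. by apply: sumr_ge0 => i _; exact: sqr_ge0. Qed.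

(** The reverse triangle inequality, squared. As [u] and [w] have equal norm, the left side can be
    distributed over both so that the inequality holds entry by entry, with gap c (u_i + w_i)^2. *)
Lemma sqnD_ge (R : realDomainType) n (u w : 'cV[R]_n) c :
  0 <= c -> sqn w = sqn u -> (1 - c) ^+ 2 * sqn u <= sqn (u + c *: w).
Proof.
move=> c0 uw.
have -> : (1 - c) ^+ 2 * sqn u =
    \sum_i ((1 - c) * u i 0 ^+ 2 + (c ^+ 2 - c) * w i 0 ^+ 2).
  by rewrite big_split/= -!mulr_sumr -/(sqn u) -/(sqn w) uw; ring.
apply: ler_sum => i _; rewrite !mxE -subr_ge0.
have -> : (u i 0 + c * w i 0) ^+ 2 -
  ((1 - c) * u i 0 ^+ 2 + (c ^+ 2 - c) * w i 0 ^+ 2) = c * (u i 0 + w i 0) ^+ 2.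
  by ring.
by rewrite mulr_ge0// sqr_ge0.
Qed.

Definition shift_mx (R : pzRingType) n : 'M[R]_n.+1 :=
  \matrix_(a, b) (ordS a == b)%:R.

Lemma shift_mxE (R : pzRingType) n p (v : 'M[R]_(n.+1, p)) a j :
  (shift_mx R n *m v) a j = v (ordS a) j.
Proof.
rewrite mxE (bigD1 (ordS a))//= mxE eqxx mul1r big1 ?addr0// => b /negPf ba.
by rewrite mxE eq_sym ba mul0r.
Qed.

Lemma shift_mxX (R : pzRingType) n i a b :
  (shift_mx R n ^+ i) a b = (iter i (@ordS n.+1) a == b)%:R.
Proof.
elim: i a => [|i IHi] a; first by rewrite expr0 mxE.
by rewrite exprS shift_mxE IHi iterSr.
Qed.

Lemma sqn_shift (R : pzRingType) n (v : 'cV[R]_n.+1) :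
  sqn (shift_mx R n *m v) = sqn v.
Proof.
rewrite /sqn [RHS](reindex_inj (can_inj (@ordSK _)))/=.
by apply: eq_bigr => i _; rewrite shift_mxE.
Qed.

Lemma iter_ordS n i (a : 'I_n.+1) : iter i (@ordS n.+1) a = ((a + i) %% n.+1)%N :> nat.
Proof.
elim: i => [|i IHi] /=; first by rewrite addn0 modn_small.
by rewrite IHi -addn1 modnDml addn1 addnS.
Qed.

Lemma cvgn_sum_ord (R : realType) n (u : nat -> 'I_n -> R) (l : 'I_n -> R) :
  (forall i, u K i @[K --> \oo] --> l i) ->
  \sum_i u K i @[K --> \oo] --> \sum_i l i.
Proof.
elim: n u l => [|n IHn] u l ul.
  by rewrite big_ord0; under eq_fun do rewrite big_ord0; exact: cvg_cst.
rewrite big_ord_recl; under eq_fun do rewrite big_ord_recl.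
by apply: cvgD; [exact: ul|apply: IHn => i; exact: ul].
Qed.

Section Theta.
Variables (R : realType) (a : R).
Hypothesis a0 : 0 < a.
Let q := expR (- a).
Let W n := qfac (q ^+ 2) n.

Let q0 : 0 < q. Proof. exact: expR_gt0. Qed.
Let q1 : q < 1. Proof. by rewrite expR_lt1 oppr_lt0. Qed.
Let qX k : 0 < q ^+ k. Proof. by rewrite exprn_gt0. Qed.
Let qX1 k : q ^+ k.+1 < 1. Proof. by rewrite exprn_ilt1// ltW. Qed.
Let qX_le k l : (k <= l)%N -> q ^+ l <= q ^+ k.
Proof. by move=> kl; rewrite ler_wiXn2l ?ltW. Qed.
Let p1 k : 0 < 1 - (q ^+ 2) ^+ k.+1.
Proof. by rewrite subr_gt0 -exprM mulnS; exact: qX1. Qed.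
Let W0 n : 0 < W n. Proof. by apply: prodr_gt0 => k _; exact: p1. Qed.
Let WS n : W n.+1 = W n * (1 - (q ^+ 2) ^+ n.+1). Proof. exact: qfacS. Qed.

(** From (1 - x) / (1 + x) = (1 - x)^2 / (1 - x^2). The right side is the prefactor in
    [theta_mx_prod] times one bound 1 - q^(2k+1) for each of the 2m factors there. *)
Lemma prod_qfac m : \prod_(n < m.*2) ((1 - q ^+ n.+1) / (1 + q ^+ n.+1)) =
  W m ^+ 2 / W m.*2 * (\prod_(k < m) (1 - q ^+ k.*2.+1)) ^+ 2.
Proof.
have -> : \prod_(n < m.*2) ((1 - q ^+ n.+1) / (1 + q ^+ n.+1)) =
    \prod_(n < m.*2) ((1 - q ^+ n.+1) ^+ 2 / (1 - (q ^+ 2) ^+ n.+1)).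
  apply: eq_bigr => n _; have := qX1 n; have := qX n.+1.
  rewrite -exprM mulnC exprM; move: (q ^+ n.+1) => x x0 x1.
  by field; apply/andP; split; rewrite gt_eqF//; nra.
rewrite big_split/= prodfV -/(W m.*2) prodrXl.
suff -> : \prod_(i < m.*2) (1 - q ^+ i.+1) =
    W m * \prod_(k < m) (1 - q ^+ k.*2.+1) by rewrite exprMn mulrAC.
elim: m => [|m IHm]; first by rewrite /W /qfac !big_ord0 mulr1.
rewrite doubleS !big_ord_recr/= IHm WS -exprM mulnC muln2 doubleS; ring.
Qed.

(* S^m times the truncation to |i| <= m of the sum over i of q^(i^2) S^i, S being
   the cyclic shift; the weights tend to 1 as m grows. *)
Definition theta_mx n m : 'M[R]_n.+1 :=
  \sum_(i < m.*2.+1)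
    (q ^+ (`|i%:Z - m%:Z| ^ 2) * (W m ^+ 2 / (W i * W (m.*2 - i)))) *: shift_mx R n ^+ i.

(** [finite_jacobi_triple] evaluated at X = S through the morphism [horner_mx]. *)
Lemma theta_mx_prod n m : theta_mx n m = (W m ^+ 2 / W m.*2) *:
  \prod_(k < m) ((1 + q ^+ k.*2.+1 *: shift_mx R n) *
                 (shift_mx R n + (q ^+ k.*2.+1)%:A)).
Proof.
have qn0 : q != 0 by rewrite gt_eqF.
have qn1 k : q ^+ k.+1 != 1 by rewrite lt_eqF.
have := congr1 (horner_mx (shift_mx R n)) (finite_jacobi_triple m qn0 qn1).
rewrite linearZ rmorph_prod raddf_sum => /(congr1 (fun M => W m ^+ 2 *: M)).
rewrite scalerA scaler_sumr => E; rewrite /theta_mx.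
transitivity (\sum_(i < m.*2.+1) W m ^+ 2 *: horner_mx (shift_mx R n)
   ((q ^+ (`|i%:Z - m%:Z| ^ 2) / (W i * W (m.*2 - i))) *: 'X^i)).
  apply: eq_bigr => i _; rewrite linearZ/= rmorphXn/= horner_mx_X scalerA.
  by rewrite mulrCA.
rewrite E; congr (_ *: _); apply: eq_bigr => k _.
by rewrite rmorphM !rmorphD rmorph1/= linearZ/= horner_mx_X horner_mx_C -scalemx1.
Qed.

Lemma sqn_theta_mx n m (v : 'cV[R]_n.+1) :
  expR (- (pi ^+ 2 / (4 * a))) ^+ 2 * sqn v <= sqn (theta_mx n m *m v).
Proof.
set S := shift_mx R n.
(* [sqnD_ge] applies twice: in 1 + c S the leading term is the identity, in S + c it is the isometry
   S. *)
have lb (c : R) (u : 'cV[R]_n.+1) : 0 <= c ->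
    (1 - c) ^+ 4 * sqn u <= sqn ((1 + c *: S) * (S + c%:A) *m u).
  move=> c0; rewrite -mulmxA.
  set w := (S + c%:A) *m u.
  have -> : (1 + c *: S) *m w = w + c *: (S *m w).
    by rewrite mulmxDl mul1mx -scalemxAl.
  apply: (le_trans _ (sqnD_ge c0 (sqn_shift w))).
  rewrite (exprD _ 2 2) -mulrA ler_wpM2l ?sqr_ge0// /w.
  rewrite mulmxDl -scalemxAl mul1mx -(sqn_shift u).
  by apply: sqnD_ge => //; rewrite sqn_shift.
have prodlb : (\prod_(k < m) (1 - q ^+ k.*2.+1)) ^+ 4 * sqn v <=
    sqn (\prod_(k < m) ((1 + q ^+ k.*2.+1 *: S) * (S + (q ^+ k.*2.+1)%:A)) *m v).
  elim: m v => [|m IHm] v; first by rewrite !big_ord0 expr1n mul1r mul1mx.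
  rewrite !big_ord_recr/= -mulmxA exprMn -mulrA.
  apply: le_trans (IHm _); rewrite ler_wpM2l ?exprn_even_ge0//.
  by apply: lb; exact/ltW/qX.
have sqnZ c (u : 'cV[R]_n.+1) : sqn (c *: u) = c ^+ 2 * sqn u.
  by rewrite /sqn mulr_sumr; apply: eq_bigr => i _; rewrite mxE exprMn.
rewrite theta_mx_prod -scalemxAl sqnZ.
apply: le_trans (ler_wpM2l (sqr_ge0 _) prodlb).
rewrite mulrA (exprM _ 2 2) -exprMn -prod_qfac ler_wpM2r ?sqn_ge0//.
by apply: lerXn2r; rewrite ?nnegrE ?expR_ge0 ?prod_theta_ge// (le_trans (expR_ge0 _) (prod_theta_ge _ a0)).
Qed.

(** * Convergence of the truncated theta matrices *)

(** The ratios W (n+1) / W n = 1 - q^(2n+2) increase with n. This keeps the weights of [theta_mx] at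
    most 1. *)
Lemma qfac_log_concave k j : W (k + j) ^+ 2 <= W k * W (k + j.*2).
Proof.
elim: j k => [|j IHj] k; first by rewrite !addn0.
rewrite addnS -addSn; apply: (le_trans (IHj _)).
rewrite WS -mulrA ler_wpM2l ?(ltW (W0 _))// mulrC addSn doubleS !addnS [leRHS]WS.
rewrite ler_wpM2l ?(ltW (W0 _))// lerB// -!exprM qX_le//; lia.
Qed.

(** Bernoulli's inequality: each of the j extra factors lies between 1 - q^(2(k+1)) and 1. *)
Lemma qfac_ge k j : W k * (1 - j%:R * q ^+ (2 * k.+1)) <= W (k + j) <= W k.
Proof.
elim: j => [|j /andP[IHj Wkj]]; first by rewrite mul0r subr0 mulr1 addn0 !lexx.
have y : q ^+ (2 * (k + j).+1) <= q ^+ (2 * k.+1) by apply: qX_le; lia.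
have := qX (2 * (k + j).+1); have := W0 (k + j).
by rewrite addnS WS -natr1 -!exprM => *; apply/andP; split; nra.
Qed.

(** At distance j from the centre m the weight is (W m)^2 / (W (m-j) W (m+j)), short of 1 by at most
    j q^(2(m-j+1)). The factor q^(j^2) makes up for the -2j in this exponent because j^2 + 1 >= 2j,
    so the bound is uniform in i. *)
Lemma theta_weight m i : (i <= m.*2)%N ->
  0 <= q ^+ (`|i%:Z - m%:Z| ^ 2) * (1 - W m ^+ 2 / (W i * W (m.*2 - i)))
    <= m%:R * q ^+ m.*2.
Proof.
move=> im; set r := W m ^+ 2 / _.
pose j := `|i%:Z - m%:Z|%N; rewrite -/j.
have jm : (j <= m)%N by rewrite /j; lia.
have rE : r = W m ^+ 2 / (W (m - j) * W (m + j)).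
  rewrite /r; congr (_ / _); have [mi|mi] := leqP m i.
    have -> : (m - j = m.*2 - i)%N by rewrite /j; lia.
    have mj : (m + j = i)%N by rewrite /j; lia.
    by rewrite mulrC mj.
  have -> : (m + j = m.*2 - i)%N by rewrite /j; lia.
  by have -> : (m - j = i)%N by rewrite /j; lia.
have r1 : r <= 1.
  rewrite rE ler_pdivrMr ?mulr_gt0// mul1r.
  have := qfac_log_concave (m - j) j.
  rewrite (_ : m - j + j.*2 = m + j)%N; last lia.
  by rewrite subnK.
have rge : 1 - j%:R * q ^+ (2 * (m - j).+1) <= r.
  have /andP[h _] := qfac_ge (m - j) j; have /andP[_ h'] := qfac_ge m j.
  rewrite subnK// in h.
  rewrite rE ler_pdivlMr ?mulr_gt0// mulrA expr2.
  have := ler_wpM2r (ltW (W0 (m + j))) h; have := ler_wpM2l (ltW (W0 m)) h'.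
  rewrite [(_ - _) * W _]mulrC => A B; exact: le_trans B A.
apply/andP; split; first by rewrite mulr_ge0 ?subr_ge0// ltW.
apply: (@le_trans _ _ (q ^+ (j ^ 2) * (j%:R * q ^+ (2 * (m - j).+1)))).
  by rewrite ler_pM2l//; lra.
rewrite mulrCA -exprD; apply: ler_pM; rewrite ?ler_nat ?(ltW (qX _))// qX_le//.
have : (j * 2 <= j * j + 1)%N by nia.
by rewrite mulnn; lia.
Qed.

Lemma iter_ordS_eq n k r (x y : 'I_n.+1) : (r < n.+1)%N ->
  (iter (k * n.+1 + r) (@ordS n.+1) x == y) = (r + x == y + (y < x) * n.+1)%N.
Proof.
move=> rn; rewrite -val_eqE /= iter_ordS addnCA modnMDl addnC.
have := ltn_ord x; have := ltn_ord y; have [xr|xr] := ltnP (r + x) n.+1.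
  by rewrite modn_small//; case: ltnP => /=; lia.
rewrite -[X in (X %% _)%N](subnK xr) modnDr modn_small; last by have := ltn_ord x; lia.
by case: ltnP => /=; lia.
Qed.

(** Each block of n+1 consecutive powers of S contains exactly one with a nonzero (x, y) entry. *)
Lemma sum_shift_entry n L (x y : 'I_n.+1) (f : nat -> R) :
  \sum_(i < L * n.+1) f i * (shift_mx R n ^+ i) x y =
  \sum_(k < L) f (k * n.+1 + (y + (y < x) * n.+1 - x))%N.
Proof.
elim: L => [|L IHL]; first by rewrite mul0n !big_ord0.
rewrite [in RHS]big_ord_recr/= mulSn addnC big_split_ord/= IHL; congr (_ + _).
have rn : (y + (y < x) * n.+1 - x < n.+1)%N.
  by have := ltn_ord x; have := ltn_ord y; case: ltnP => /=; lia.
rewrite (bigD1 (Ordinal rn))//= big1 => [|r].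
  rewrite addr0 shift_mxX iter_ordS_eq// subnK ?eqxx ?mulr1//.
  by have := ltn_ord x; case: ltnP => /=; lia.
rewrite -val_eqE /= => rE; rewrite shift_mxX iter_ordS_eq//.
case: eqP => [e|]; last by rewrite mulr0.
by move: rE; rewrite -e addnK eqxx.
Qed.

(** The windows [d - K, d + K) exhaust the integers, so the offset d does not affect the limit. The
    bound [C] makes the extended sum finite; on an infinite one [fine] would return 0. *)
Lemma cvg_int_window (g : int -> R) (d : int) (C : R) :
  (forall x, 0 <= g x) ->
  (forall K, \sum_(k < K.*2) g (k%:Z - K%:Z + d) <= C) ->
  \sum_(k < K.*2) g (k%:Z - K%:Z + d) @[K --> \oo] -->
  fine (\esum_(x in [set: int]) (g x)%:E).
Proof.
move=> g0 gC; set w := fun K => _; set E := esum _ _.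
have wE K : (w K)%:E =
    (\sum_(x \in [set` [seq (k%:Z - K%:Z + d)%R | k <- iota 0 K.*2]]) (g x)%:E)%E.
  rewrite -fsbig_seq; last first.
    by rewrite map_inj_uniq ?iota_uniq// => i j; lia.
  rewrite big_map sumEFin; congr EFin.
  by rewrite /w -(big_mkord xpredT (fun k => g (k%:Z - K%:Z + d))) /index_iota subn0.
have wle K : ((w K)%:E <= E)%E.
  rewrite wE; apply: esum_ge.
  by exists [set` [seq (k%:Z - K%:Z + d)%R | k <- iota 0 K.*2]] => //; split=> //; exact: finite_seq.
have lew (X : set int) : finite_set X -> exists K0, forall K, (K0 <= K)%N ->
    (\sum_(x \in X) (g x)%:E <= (w K)%:E)%E.
  move=> /finite_seqP[s ->]; exists (\max_(x <- s) `|(x - d)%R|.+1)%N => K K0.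
  rewrite wE; apply: lee_fsum_nneg_subset; rewrite ?lee_fin//; try exact: finite_seq.
    move=> x; rewrite !inE /= => sx.
    have xK : (`|(x - d)%R| < K)%N.
      by apply: leq_trans K0; exact: (@leq_bigmax_seq _ s xpredT (fun x : int => `|(x - d)%R|.+1)).
    by apply/mapP; exists `|(x - d + K%:Z)%R|%N; rewrite ?mem_iota; lia.
  by move=> x _; rewrite lee_fin.
have EC : (E <= C%:E)%E.
  apply: ge_ereal_sup => _ [Y [fY _] <-]; have [K0 h] := lew Y fY.
  by apply: (le_trans (h K0 _)) => //; rewrite lee_fin gC.
have Efin : E \is a fin_num.
  by rewrite ge0_fin_numE ?(le_lt_trans EC) ?ltry// esum_ge0// => x _; rewrite lee_fin.
apply/cvgrPdist_le => e e0.
have [_ [X [fX _] <-] hX] := ub_ereal_sup_adherent e0 Efin.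
have [K0 h] := lew X fX.
near=> K.
have := wle K; have : (E - e%:E < (w K)%:E)%E.
  by apply: (lt_le_trans hX); apply: h; near: K; exact: nbhs_infty_ge.
rewrite -(fineK Efin) -EFinB lte_fin lee_fin => h1 h2.
by rewrite ler_norml; apply/andP; split; lra.
Unshelve. all: by end_near.
Qed.

(** Each half of the window is dominated by a geometric series, as j^2 >= j. *)
Lemma sum_qX_dist_le m : \sum_(i < m.*2) q ^+ (`|i%:Z - m%:Z| ^ 2) <= 2 / (1 - q).
Proof.
have geo : \sum_(i < m) q ^+ i <= (1 - q)^-1.
  have q2 : 0 < 1 - q by rewrite subr_gt0.
  rewrite -(ler_pM2l q2) divff ?gt_eqF// -opprB mulNr -subrX1 opprB.
  by rewrite gerBl ltW.
rewrite -addnn big_split_ord/= mulrC mulr_natr mulr2n lerD//.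
  rewrite (reindex_inj rev_ord_inj)/=; apply: le_trans geo; apply: ler_sum => i _.
  apply: qX_le; have -> : `|(m - i.+1)%N%:Z - m%:Z|%N = i.+1 by have := ltn_ord i; lia.
  by nia.
apply: le_trans geo; apply: ler_sum => i _; apply: qX_le.
have -> : `|(m + i)%N%:Z - m%:Z|%N = i by lia.
by nia.
Qed.

(** By t <= e^t at t = a m / 2, half of the decay of q^m absorbs a factor m; the result is then
    squared. *)
Lemma sqr_expR_le m : m%:R ^+ 2 * q ^+ m.*2 <= 4 / a ^+ 2 * q ^+ m.
Proof.
have h : m%:R * q ^+ m <= 2 / a * expR (- (a * m%:R / 2)).
  have e : expR (a * m%:R / 2) * expR (- (a * m%:R / 2)) = 1 by rewrite expRxMexpNx_1.
  have -> : q ^+ m = expR (- (a * m%:R / 2)) * expR (- (a * m%:R / 2)).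
    by rewrite -expRD -expRM_natr; congr expR; lra.
  rewrite mulrA ler_pM2r ?expR_gt0//.
  have am : a * m%:R / 2 <= expR (a * m%:R / 2).
    by apply: le_trans (expR_ge1Dx _); lra.
  have := ler_wpM2r (expR_ge0 (- (a * m%:R / 2))) am.
  rewrite e; set u := expR _ => hu.
  have -> : m%:R * u = 2 / a * (a * m%:R / 2 * u) by field; rewrite gt_eqF.
  by rewrite -[leRHS]mulr1 ler_pM2l// divr_gt0.
have -> : m%:R ^+ 2 * q ^+ m.*2 = (m%:R * q ^+ m) ^+ 2.
  by rewrite exprMn -exprM muln2.
have -> : 4 / a ^+ 2 * q ^+ m = (2 / a * expR (- (a * m%:R / 2))) ^+ 2.
  rewrite exprMn -[X in _ * X]expRM_natr -expRM_natr.
  congr (_ * expR _); last by lra.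
  by field; rewrite gt_eqF.
apply: lerXn2r => //; rewrite nnegrE mulr_ge0 ?expR_ge0 ?(ltW (qX _))//.
by rewrite divr_ge0 ?(ltW a0).
Qed.

(* Entry (x, y) of the circulant matrix sum_i q^(i^2) S^i, i ranging over Z. *)
Definition lattice_theta n (x y : 'I_n.+1) : R :=
  fine (\esum_(m in [set: int])
    (q ^+ (`|(x%:Z - y%:Z - m * n.+1%:Z)%R| ^ 2))%:E).

(* As S^(n+1) = 1, the factor S^m disappears for m = K (n+1). *)
Lemma theta_window_cvg n (x y : 'I_n.+1) :
  \sum_(i < (K * n.+1).*2) q ^+ (`|i%:Z - (K * n.+1)%:Z| ^ 2) * (shift_mx R n ^+ i) x y
    @[K --> \oo] --> lattice_theta x y.
Proof.
pose g (m : int) := q ^+ (`|(x%:Z - y%:Z - m * n.+1%:Z)%R| ^ 2).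
(* In block k the exponent i satisfies K (n+1) - i = x - y - (k - K + [y < x]) (n+1): the window is
   offset by one when y < x. *)
have wE K : \sum_(i < (K * n.+1).*2) q ^+ (`|i%:Z - (K * n.+1)%:Z| ^ 2) *
    (shift_mx R n ^+ i) x y = \sum_(k < K.*2) g (k%:Z - K%:Z + (y < x)%N%:Z).
  rewrite doubleMl (sum_shift_entry _ _ _ (fun i => q ^+ (`|i%:Z - (K * n.+1)%:Z| ^ 2))).
  apply: eq_bigr => k _; rewrite /g; congr (_ ^+ (_ ^ 2)).
  rewrite -[RHS]abszN; congr absz.
  rewrite PoszD !PoszM -subzn; last by have := ltn_ord x; case: ltnP => /=; lia.
  by rewrite PoszD PoszM; ring.
rewrite (_ : (fun K : nat => _) = (fun K => \sum_(k < K.*2) g (k%:Z - K%:Z + (y < x)%N%:Z))); last first.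
  by apply/funext => K; exact: wE.
apply: (@cvg_int_window g _ (2 / (1 - q))) => [m|K]; first by rewrite exprn_ge0// ltW.
rewrite -wE; apply: le_trans (sum_qX_dist_le (K * n.+1)).
apply: ler_sum => i _; rewrite shift_mxX.
by case: (_ == _); rewrite ?mulr1// mulr0 ltW.
Qed.

Lemma theta_mx_cvg n (x y : 'I_n.+1) :
  theta_mx n (K * n.+1) x y @[K --> \oo] --> lattice_theta x y.
Proof.
pose w K := \sum_(i < (K * n.+1).*2)
  q ^+ (`|i%:Z - (K * n.+1)%:Z| ^ 2) * (shift_mx R n ^+ i) x y.
(* With m = K (n+1), the 1 pays for the term i = 2m, which the window of [theta_window_cvg] leaves
   out; the rest pays for the weight defects, in total at most (2m+1) m q^(2m) <= 3 m^2 q^(2m). *)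
pose C := 1 + 3 * (4 / a ^+ 2).
have S01 i : 0 <= (shift_mx R n ^+ i) x y <= 1.
  by rewrite shift_mxX; case: (_ == _); rewrite lexx ler01.
have C0 : 0 <= C by rewrite addr_ge0// mulr_ge0// divr_ge0// sqr_ge0.
have err K : w K - C * q ^+ K <= theta_mx n (K * n.+1) x y <= w K + C * q ^+ K.
  rewrite /w; set m := (K * n.+1)%N.
  have mK : C * q ^+ m <= C * q ^+ K.
    by rewrite ler_wpM2l// qX_le// leq_pmulr.
  pose F i := q ^+ (`|i%:Z - m%:Z| ^ 2).
  pose r i := W m ^+ 2 / (W i * W (m.*2 - i)).
  pose s := \sum_(i < m.*2.+1) F i * (1 - r i) * (shift_mx R n ^+ i) x y.
  have -> : theta_mx n m x y = \sum_(i < m.*2) F i * (shift_mx R n ^+ i) x y +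
      F m.*2 * (shift_mx R n ^+ m.*2) x y - s.
    have -> : \sum_(i < m.*2) F i * (shift_mx R n ^+ i) x y +
      F m.*2 * (shift_mx R n ^+ m.*2) x y =
      \sum_(i < m.*2.+1) F i * (shift_mx R n ^+ i) x y by rewrite big_ord_recr.
    rewrite /theta_mx summxE -sumrB; apply: eq_bigr => i _.
    by rewrite mxE /F /r; ring.
  have /andP[S0 S1] := S01 m.*2.
  have Fm : F m.*2 <= q ^+ m.
    apply: qX_le; rewrite (_ : `|m.*2%:Z - m%:Z|%N = m); last lia.
    by rewrite -mulnn; nia.
  have F0 : 0 <= F m.*2 * (shift_mx R n ^+ m.*2) x y by rewrite mulr_ge0//; exact/ltW/qX.
  have F1 : F m.*2 * (shift_mx R n ^+ m.*2) x y <= q ^+ m.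
    by apply: le_trans Fm; rewrite ler_piMr//; exact/ltW/qX.
  have s0 : 0 <= s.
    apply: sumr_ge0 => i _; have /andP[h _] := theta_weight (ltn_ord i : (i <= m.*2)%N).
    by have /andP[? _] := S01 i; rewrite mulr_ge0.
  have s1 : s <= 3 * (4 / a ^+ 2) * q ^+ m.
    apply: (@le_trans _ _ (\sum_(i < m.*2.+1) m%:R * q ^+ m.*2)).
      apply: ler_sum => i _; have /andP[h0 h] := theta_weight (ltn_ord i : (i <= m.*2)%N).
      by have /andP[? ?] := S01 i; apply: le_trans h; rewrite ler_piMr.
    rewrite sumr_const card_ord -[leLHS]mulr_natl.
    apply: (@le_trans _ _ (3 * (m%:R ^+ 2 * q ^+ m.*2))); last first.
      by rewrite -[leRHS]mulrA ler_pM2l// sqr_expR_le.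
    rewrite [leLHS]mulrA [leRHS]mulrA ler_pM2r// -natrX -!natrM ler_nat -muln2; nia.
  have qm := qX m; move: mK; rewrite /C mulrDl mul1r => mK.
  by rewrite -/(F _); apply/andP; split; lra.
have cK : C * q ^+ K @[K --> \oo] --> (0 : R).
  by apply: cvg_geometric; rewrite ger0_norm// ltW.
apply: (@squeeze_cvgr _ _ _ _ (fun K => w K - C * q ^+ K) (fun K => w K + C * q ^+ K)).
- by near=> K; exact: err.
- rewrite -[lattice_theta x y]subr0; apply: cvgB cK; exact: theta_window_cvg.
- rewrite -[lattice_theta x y]addr0; apply: cvgD cK; exact: theta_window_cvg.
Unshelve. all: by end_near.
Qed.

(** The bound in [sqn_theta_mx] does not depend on the truncation, so it passes to the limit. *)
Lemma sqn_lattice_theta n (v : 'cV[R]_n.+1) :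
  expR (- (pi ^+ 2 / (4 * a))) ^+ 2 * sqn v <=
  sqn ((\matrix_(x, y) lattice_theta x y) *m v).
Proof.
have c : sqn (theta_mx n (K * n.+1) *m v) @[K --> \oo] -->
    sqn ((\matrix_(x, y) lattice_theta x y) *m v).
  apply: cvgn_sum_ord => x; under eq_fun do rewrite expr2.
  suff h : (theta_mx n (K * n.+1) *m v) x 0 @[K --> \oo] -->
      ((\matrix_(x, y) lattice_theta x y) *m v) x 0.
    by rewrite expr2; exact: cvgM.
  rewrite mxE; under eq_fun do rewrite mxE.
  apply: cvgn_sum_ord => y; rewrite mxE; apply: cvgM; last exact: cvg_cst.
  exact: theta_mx_cvg.
apply: (ler_cvg_to (cvg_cst _) c).
by near=> K; exact: sqn_theta_mx.
Unshelve. all: by end_near.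
Qed.

End Theta.

End Limits.

(** * Unitarity of the Fourier matrices *)

Section DFT.
Local Open Scope sesquilinear_scope.
Local Open Scope complex_scope.

Section Cis.
Variable R : realType.
Implicit Types t u : R.

Lemma cisD t u : cis (t + u) = cis t * cis u.
Proof.
by apply/eqP; rewrite eq_complex /= cosD sinD; apply/andP; split; apply/eqP; ring.
Qed.

Lemma cis0 : cis (0 : R) = 1.
Proof. by rewrite /cis cos0 sin0. Qed.

Lemma conj_scaled_cis (x t : R) : Num.conj (x%:C * cis t) = x%:C * cis (- t).
Proof.
apply/eqP; rewrite eq_complex /= cosN sinN !mul0r !subr0 !addr0 mulrN eqxx/=.
by apply/eqP.
Qed.

Lemma conj_cis t : Num.conj (cis t) = cis (- t).
Proof. by have := conj_scaled_cis 1 t; rewrite !mul1r. Qed.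

Lemma cisMn t n : cis (t * n%:R) = cis t ^+ n.
Proof.
elim: n => [|n IHn]; first by rewrite mulr0 cis0.
by rewrite -natr1 mulrDr mulr1 cisD IHn exprSr.
Qed.

Lemma cis_2pin n : cis (2 * pi * n%:R : R) = 1.
Proof.
rewrite cisMn -[X in _ = X](expr1n _ n); congr (_ ^+ _).
by rewrite /cis mulrC mulr_natr cos2pi sin2pi.
Qed.

Lemma cis_neq1 t : 0 < t < 2 * pi -> cis t != 1.
Proof.
move=> /andP[t0 t2]; apply/eqP => /(congr1 (@complex.Re R)) /= ct.
have st : 0 < sin (t / 2) by apply: sin_gt0_pi; apply/andP; split; lra.
have := cos_mulr2n (t / 2); rewrite -(mulr_natr (t / 2)) divfK// ct cos2sin2.
by have := exprn_gt0 2 st; lra.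
Qed.

End Cis.

Lemma sum_unity_root (F : fieldType) (z : F) N : z ^+ N = 1 -> z != 1 ->
  \sum_(k < N) z ^+ k = 0.
Proof.
move=> zN z1; have := subrX1 z N; rewrite zN subrr => /esym/eqP.
by rewrite mulf_eq0 subr_eq0 (negPf z1) => /eqP.
Qed.

(** Entry (j, l) is 1 / N times the geometric sum of z = e^(2 pi i (j - l) / N), an N-th root of
    unity other than 1 off the diagonal. *)
Lemma DFT_unitary (R : realType) N : (DFT N : 'M[R[i]]_N) *m (DFT N) ^t* = 1%:M.
Proof.
apply/matrixP => j l; rewrite !mxE.
have N0 : N%:R != 0 :> R by rewrite pnatr_eq0 -lt0n (leq_ltn_trans _ (ltn_ord j)).
pose z := cis (2 * pi * (j%:R / N%:R : R)) * cis (- (2 * pi * (l%:R / N%:R))).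
transitivity ((N%:R^-1)%:C * \sum_(k < N) z ^+ k).
  rewrite mulr_sumr; apply: eq_bigr => k _; rewrite !mxE conj_scaled_cis.
  rewrite mulrACA -rmorphM/= -invfM -expr2 sqr_sqrtr ?ler0n//; congr (_ * _).
  rewrite /z -cisD -cisMn -cisD; congr cis; rewrite !natrM; field.
  exact: N0.
have [e|jl] := eqVneq j l.
  have -> : z = 1 by rewrite /z e -cisD subrr cis0.
  under eq_bigr do rewrite expr1n.
  rewrite sumr_const card_ord -(rmorph_nat (real_complex R)) -rmorphM/=.
  by rewrite mulVf.
rewrite sum_unity_root ?mulr0//.
  rewrite /z exprMn -!cisMn mulNr -!mulrA !mulVf// !mulr1 !mulrA cis_2pin mul1r.
  by rewrite -conj_cis cis_2pin rmorph1.
have NR : 0 < N%:R :> R by rewrite lt_neqAle eq_sym N0 ler0n.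
have d (x y : 'I_N) : (x < y)%N ->
    cis (2 * pi * (y%:R / N%:R : R)) * cis (- (2 * pi * (x%:R / N%:R))) != 1.
  move=> xy; rewrite -cisD -mulrBr -mulrBl; apply: cis_neq1.
  have p := @pi_gt0 R.
  have xyR : (x%:R < y%:R :> R) by rewrite ltr_nat.
  have yN : (y%:R < N%:R :> R) by rewrite ltr_nat.
  rewrite mulr_gt0 ?divr_gt0 ?subr_gt0 ?mulr_gt0//= -[ltRHS]mulr1.
  rewrite ltr_pM2l ?mulr_gt0// ltr_pdivrMr// mul1r.
  by have := ler0n R x; lra.
(* [d] covers l < j, where the angle lies in ]0, 2 pi[; for j < l conjugation exchanges the
   indices. *)
case: (ltngtP j l) => [jl'|lj|/val_inj e]; last by rewrite e eqxx in jl.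
  apply/negP => /eqP /(congr1 Num.conj) E.
  have /eqP := d _ _ jl'; apply; move: E; rewrite /z rmorphM/= !conj_cis opprK rmorph1.
  by rewrite mulrC.
exact: d.
Qed.

Lemma blockDFT_unitary (R : realType) N s :
  (blockDFT N s : 'M[R[i]]_(s * N)) ^t* *m blockDFT N s = 1%:M.
Proof.
rewrite /blockDFT trmx_tens map_mxT tensmx_mul trmx1 map_mx1 mul1mx trmxCK.
rewrite DFT_unitary; apply/matrixP => p q.
have [i j] := mxtens_indexP p; have [k l] := mxtens_indexP q.
rewrite tensmxE !mxE -natrM mulnb; congr ((_ : bool)%:R).
by rewrite (inj_eq (can_inj (@mxtens_indexK _ _))) xpair_eqE.
Qed.

(** Unitary changes of basis on either side preserve the four Penrose conditions. *)
Lemma pinv_unitary (C : numClosedFieldType) m n (P : 'M[C]_m) (Q : 'M[C]_(m, n))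
    (F : 'M[C]_n) (Y : 'M[C]_(n, m)) :
  P ^t* *m P = 1%:M -> F *m F ^t* = 1%:M -> penrose Q Y ->
  Defs.pinv (P *m Q *m F) = F ^t* *m Y *m P ^t*.
Proof.
move=> PP FF [QYQ YQY QY YQ]; apply: pinvE.
have BX : P *m Q *m F *m (F ^t* *m Y *m P ^t*) = P *m (Q *m Y) *m P ^t*.
  by rewrite -!mulmxA (mulmxA F) FF mul1mx.
have XB : F ^t* *m Y *m P ^t* *m (P *m Q *m F) = F ^t* *m (Y *m Q) *m F.
  by rewrite -!mulmxA (mulmxA (P ^t*)) PP mul1mx.
split.
- by rewrite BX -!mulmxA (mulmxA (P ^t*)) PP mul1mx !(mulmxA Q) !(mulmxA (Q *m Y)) QYQ.
- by rewrite XB -!mulmxA (mulmxA F) FF mul1mx !(mulmxA Y) !(mulmxA (Y *m Q)) YQY.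
- by rewrite BX !trmxCM trmxCK -trmxCM QY !mulmxA.
- by rewrite XB !trmxCM trmxCK -trmxCM YQ !mulmxA.
Qed.

Lemma penrose_gram (R : realType) m n (Q : 'M[R]_(m, n)) : Q^T *m Q \in unitmx ->
  penrose (mxC Q) (mxC (invmx (Q^T *m Q) *m Q^T)).
Proof.
move=> G1.
have conjE p r (M : 'M[R]_(p, r)) : (mxC M) ^t* = mxC M^T.
  by apply/matrixP => i j; rewrite !mxE; exact: conjc_real.
have GT : (invmx (Q^T *m Q))^T = invmx (Q^T *m Q).
  by rewrite trmx_inv trmx_mul trmxK.
split; rewrite -!mxCM.
- by rewrite -!mulmxA mulVmx// mulmx1.
- by rewrite -!mulmxA (mulmxA Q^T) mulKVmx.
- by rewrite conjE !trmx_mul trmxK GT !mulmxA.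
- by rewrite conjE -!mulmxA mulVmx// trmx1.
Qed.

(** By [pinv_unitary] the Fourier factors inside the pseudo-inverse cancel those around it; what
    remains is the real left inverse of [Q] applied after zero-padding. *)
Lemma Zstar_real (R : realType) (T : R) N s eps :
  let Q := Pi N s *m Ac T N s eps in
  Q^T *m Q \in unitmx ->
  Zstar T N s eps = mxC (invmx (Q^T *m Q) *m Q^T *m (restriction T N s)^T).
Proof.
move=> Q QQ; rewrite /Zstar /Bmx.
rewrite (pinv_unitary (blockDFT_unitary _ _ _) (DFT_unitary _ _) (penrose_gram QQ)).
rewrite -/Q extensionE [in RHS]mxCM -!mulmxA.
by rewrite (mulmxA ((blockDFT N s) ^t*)) blockDFT_unitary mul1mx mulmxA DFT_unitary mul1mx.
Qed.

End DFT.

(** * The AZ algorithm *)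

Lemma sqnE (R : pzRingType) n (v : 'cV[R]_n) : (v^T *m v) 0 0 = sqn v.
Proof. by rewrite mxE; apply: eq_bigr => i _; rewrite mxE expr2. Qed.

Lemma sqn_eq0 (R : realDomainType) n (v : 'cV[R]_n) : sqn v = 0 -> v = 0.
Proof.
move=> /eqP; rewrite psumr_eq0 => [/allP h|i _]; last exact: sqr_ge0.
apply/colP => i; apply/eqP; have := h i (mem_index_enum i).
by rewrite sqrf_eq0 mxE.
Qed.

Lemma enorm_sqr (R : realType) n (v : 'cV[R]_n) : enorm v ^+ 2 = sqn v.
Proof. by rewrite sqr_sqrtr// sqn_ge0. Qed.

Lemma enorm_ge0 (R : realType) n (v : 'cV[R]_n) : 0 <= enorm v.
Proof. exact: sqrtr_ge0. Qed.

Lemma enorm_le (R : realType) n (v : 'cV[R]_n) (c : R) : 0 <= c ->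
  (enorm v <= c) = (sqn v <= c ^+ 2).
Proof. by move=> c0; rewrite -enorm_sqr ler_pXn2r// nnegrE// enorm_ge0. Qed.

Lemma sqnD_le (R : realDomainType) n (u v : 'cV[R]_n) :
  sqn (u + v) <= 2 * sqn u + 2 * sqn v.
Proof.
rewrite /sqn !mulr_sumr -big_split/=; apply: ler_sum => i _.
by rewrite mxE; have := sqr_ge0 (u i 0 - v i 0); lra.
Qed.

(** Pythagoras: an orthogonal projection splits [w] into two orthogonal pieces. *)
Lemma sqn_proj_le (R : realDomainType) n (P : 'M[R]_n) (w : 'cV[R]_n) :
  P^T = P -> P *m P = P -> sqn (P *m w) <= sqn w /\ sqn (w - P *m w) <= sqn w.
Proof.
move=> PT PP.
suff e : sqn (P *m w) + sqn (w - P *m w) = sqn w.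
  by have := sqn_ge0 (P *m w); have := sqn_ge0 (w - P *m w); split; lra.
have wP : (P *m w)^T = w^T *m P by rewrite trmx_mul PT.
rewrite -!sqnE [(w - _)^T]linearB/= wP mulmxBl !mulmxBr -!mulmxA !(mulmxA P P) PP.
by rewrite !mxE; ring.
Qed.

Section LeastSquares.
Variables (R : realType) (m n p : nat).
Variables (Q : 'M[R]_(m, n)) (E : 'M[R]_(p, m)) (lam : R).
Hypothesis lam0 : 0 < lam.
Hypothesis Q_lb : forall v : 'cV[R]_n, lam * sqn v <= sqn (Q *m v).
Hypothesis EE : E *m E^T = 1%:M.

Lemma gram_unit : Q^T *m Q \in unitmx.
Proof.
rewrite -row_free_unit -kermx_eq0; apply/rowV0P => v /sub_kermxP vQ.
apply: trmx_inj; rewrite trmx0; apply: sqn_eq0.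
have : sqn (Q *m v^T) = 0.
  by rewrite -sqnE trmx_mul trmxK mulmxA -(mulmxA v) vQ mul0mx mxE.
move=> Qv; have := Q_lb v^T; rewrite Qv => h; apply/le_anti; rewrite sqn_ge0 andbT.
by rewrite -(ler_pM2l lam0) mulr0.
Qed.

Let Qp := invmx (Q^T *m Q) *m Q^T.

Let PP : (Q *m Qp) *m (Q *m Qp) = Q *m Qp.
Proof.
by rewrite /Qp -!mulmxA; congr (_ *m _); rewrite (mulmxA Q^T) mulKVmx// gram_unit.
Qed.

Let PT : (Q *m Qp)^T = Q *m Qp.
Proof. by rewrite /Qp !trmx_mul trmx_inv trmx_mul trmxK mulmxA. Qed.

Let sqn_extend (r : 'cV[R]_p) : sqn (E^T *m r) = sqn r.
Proof. by rewrite -!sqnE trmx_mul trmxK mulmxA -(mulmxA r^T) EE mulmx1. Qed.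

(* The residual is E (I - P) E^T r, with P the orthogonal projection onto the
   range of Q. *)
Lemma sqn_AZ_residual (r : 'cV[R]_p) :
  sqn (r - E *m Q *m (Qp *m E^T *m r)) <= sqn r.
Proof.
have -> : r - E *m Q *m (Qp *m E^T *m r) = E *m (E^T *m r - Q *m Qp *m (E^T *m r)).
  by rewrite mulmxBr [E *m (E^T *m r)]mulmxA EE mul1mx !mulmxA.
set w := _ - _.
have [_ h] := sqn_proj_le (E^T *m r) PT PP.
apply: (le_trans _ (le_trans h _)); last by rewrite sqn_extend.
(* |E w| = |E^T E w|, and E^T E is an orthogonal projection, so restricting [w] does not lengthen
   it. *)
have ET : (E^T *m E)^T = E^T *m E by rewrite trmx_mul trmxK.
have EE2 : E^T *m E *m (E^T *m E) = E^T *m E by rewrite -!mulmxA (mulmxA E) EE mul1mx.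
have [hw _] := sqn_proj_le w ET EE2; apply: le_trans hw.
by rewrite le_eqVlt -!sqnE !trmx_mul trmxK -!mulmxA (mulmxA E E^T) EE mul1mx !mulmxA eqxx.
Qed.

(** [Q] maps the correction to the projection of E^T r onto its range, which is no longer than r;
    [Q_lb] then bounds the correction itself. *)
Lemma sqn_AZ_correction (r : 'cV[R]_p) : lam * sqn (Qp *m E^T *m r) <= sqn r.
Proof.
apply: (le_trans (Q_lb _)); rewrite -sqn_extend mulmxA mulmxA -mulmxA.
by have [] := sqn_proj_le (E^T *m r) PT PP.
Qed.

End LeastSquares.

Lemma restriction_trmx (R : realType) (T : R) N s :
  restriction T N s *m (restriction T N s)^T = 1%:M.
Proof.
apply/matrixP => i j; rewrite mxE (bigD1 (enum_val i))//= big1 => [|p pi].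
  by rewrite !mxE eqxx mul1r addr0 (inj_eq enum_val_inj) eq_sym.
by rewrite !mxE eq_sym (negPf pi) mul0r.
Qed.

(** * Lower bound for the permuted RBF matrix *)

Lemma Pi_Ac_entry (R : realType) (T : R) N s eps p (j : 'I_N) :
  (Pi N s *m Ac T N s eps) p j =
  gaussian_per T eps (grid T N s (unpermuted p) - Defs.center T j).
Proof.
rewrite mxE (bigD1 (Ordinal (unpermuted_lt p)))//= big1 => [|q qi].
  by rewrite addr0 !mxE eqxx mul1r.
by rewrite mxE eq_sym; move: qi; rewrite -val_eqE /= => /negPf ->; rewrite mul0r.
Qed.

(** With spacing h = 2T / (n+1), one period is (n+1) h, so the periodized Gaussian becomes a theta
    series with q = e^(-(eps h)^2). *)
Lemma gaussian_per_lattice (R : realType) (T eps : R) n (x y : 'I_n.+1) :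
  gaussian_per T eps ((x%:R - y%:R) * (2 * T / n.+1%:R)) =
  lattice_theta ((eps * (2 * T / n.+1%:R)) ^+ 2) x y.
Proof.
rewrite /gaussian_per /lattice_theta; congr fine; apply: eq_esum => m _; congr EFin.
rewrite /gaussian -expRM_natr; congr expR.
have -> : (`|(x%:Z - y%:Z - m * n.+1%:Z)%R| ^ 2)%:R =
    (x%:R - y%:R - m%:~R * n.+1%:R) ^+ 2 :> R.
  rewrite natrX pmulrn abszE -rmorphXn/= real_normK ?num_real//.
  by rewrite rmorphXn/= !rmorphB/= rmorphM.
by have := pnatr_eq0 R n.+1; move: (_.+1%:R) => N N0; field; rewrite N0.
Qed.

(* The rows of the first block sit at the centers and form the circulant matrix
   of [lattice_theta]; the other rows only increase the norm. *)
Lemma sqn_Pi_Ac_ge (R : realType) (T eps : R) n s (v : 'cV[R]_n.+1) :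
  0 < T -> 0 < eps ->
  expR (- (pi ^+ 2 / (4 * (eps * (2 * T / n.+1%:R)) ^+ 2))) ^+ 2 * sqn v
  <= sqn (Pi n.+1 s.+1 *m Ac T n.+1 s.+1 eps *m v).
Proof.
move=> T0 eps0; set a := (eps * _) ^+ 2.
have a0 : 0 < a by rewrite exprn_gt0// mulr_gt0// divr_gt0 ?mulr_gt0.
apply: (le_trans (sqn_lattice_theta a0 v)).
set M := Pi _ _ *m _.
pose h (x : 'I_n.+1) : 'I_(s.+1 * n.+1) := lshift (s * n.+1) x.
have ME x y : M (h x) y = lattice_theta a x y.
  rewrite Pi_Ac_entry -gaussian_per_lattice; congr (gaussian_per _ _ _).
  have -> : unpermuted (h x) = (x * s.+1)%N.
    by rewrite /unpermuted /= divn_small// modn_small.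
  rewrite /grid /Defs.center !natrM.
  have : s.+1%:R != 0 :> R by rewrite pnatr_eq0.
  have : n.+1%:R != 0 :> R by rewrite pnatr_eq0.
  by move: (n.+1%:R) (s.+1%:R) => u w u0 w0; field; rewrite u0 w0.
have -> : sqn (M *m v) = \sum_x (M *m v) (h x) 0 ^+ 2 +
    \sum_x (M *m v) (rshift n.+1 x : 'I_(n.+1 + s * n.+1)) 0 ^+ 2.
  exact: (@big_split_ord _ _ _ n.+1 (s * n.+1)).
rewrite ler_wpDr ?sumr_ge0// => [x _|]; first exact: sqr_ge0.
apply: ler_sum => x _; rewrite le_eqVlt; apply/orP; left; apply/eqP.
by congr (_ ^+ 2); rewrite !mxE; apply: eq_bigr => y _; rewrite ME mxE.
Qed.

(** With l = ln (1 + tau^(-2)), the shape parameter times the spacing of the centers is pi / sqrt (2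
    l). Hence a = pi^2 / (2 l), pi^2 / (4 a) = l / 2, and the square of e^(-l/2) is e^(-l). *)
Lemma shape_param_exponent (R : realType) (T tau : R) n :
  1 < T -> 0 < tau ->
  0 < shape_param T n.+1 tau /\
  expR (- (pi ^+ 2 / (4 * (shape_param T n.+1 tau * (2 * T / n.+1%:R)) ^+ 2))) ^+ 2
    = (1 + tau ^- 2)^-1.
Proof.
move=> T1 t0; rewrite /shape_param; set l := ln _.
have t1 : 1 < 1 + tau ^- 2 by rewrite ltrDl invr_gt0 exprn_gt0.
have l0 : 0 < l by rewrite ln_gt0.
have s0 : 0 < Num.sqrt (2 * l) by rewrite sqrtr_gt0 mulr_gt0.
have ss : Num.sqrt (2 * l) ^+ 2 = 2 * l by rewrite sqr_sqrtr// ltW// mulr_gt0.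
have p0 : pi != 0 :> R by rewrite gt_eqF// pi_gt0.
have n0 : n.+1%:R != 0 :> R by rewrite pnatr_eq0.
split.
  by rewrite mulr_gt0// divr_gt0 ?pi_gt0// mulr_gt0// mulr_gt0//; lra.
rewrite -expRM_natr mulNr expRN; congr (_^-1).
rewrite -[RHS]lnK; last by rewrite posrE; lra.
rewrite -/l; congr expR.
have -> : pi / (2 * T * Num.sqrt (2 * l)) * n.+1%:R * (2 * T / n.+1%:R) =
    pi / Num.sqrt (2 * l).
  move: (pi) => c; move: (n.+1%:R) n0 => k k0; field.
  by rewrite k0 gt_eqF//= gt_eqF//; lra.
rewrite expr_div_n ss; move: (pi) p0 => c c0; field.
by rewrite c0 gt_eqF.
Qed.

(** The residual of step (1) is (I - A Z) r, and [cnorm] agrees with [enorm] on real vectors. *)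
Lemma AZ_solution_real (R : realType) m n (A : 'M[R]_(m, n)) (Z : 'M[R]_(n, m))
    (b : 'cV[R]_m) (x2 : 'cV[R]_n) (tol : R) :
  let r := b - A *m x2 in
  enorm (r - A *m (Z *m r)) <= tol ->
  AZ_solution (mxC A) (mxC Z) (mxC b) tol (mxC x2) (mxC (x2 + Z *m r)).
Proof.
move=> r h; have rE : mxC r = mxC b - mxC A *m mxC x2.
  by rewrite -mxCM /mxC -map_mxB.
split; last first.
  by exists (mxC (Z *m r)); [rewrite mxCM rE|rewrite /mxC map_mxD addrC].
rewrite -mulmxA -mulmxBr -rE mulmxBl mul1mx -!mulmxA -!mxCM.
by rewrite /mxC -map_mxB cnorm_mxC.
Qed.

Theorem theorem4p5 (R : realType) (T : R) (N s : nat) (f : R -> R) (C D : R)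
    (hT : 1 < T) (hN : (0 < N)%N) (hs : (0 < s)%N)
    (hM : (N < ncolloc T N s)%N) (hC : 0 < C) (hD : 0 < D) :
  exists2 E0 : R, 0 < E0 &
    forall tau0 : R, 0 < tau0 ->
      let eps := shape_param T N tau0 in
      let A := collocation_mx T N s eps in
      let b := rhs T N s f in
      (exists xt : 'cV[R]_N, enorm (b - A *m xt) <= C * tau0 /\ enorm xt <= D) ->
      exists x2 x : 'cV[R]_N,
        [/\ AZ_solution (mxC A) (Zstar T N s eps) (mxC b) (C * tau0)
              (mxC x2) (mxC x),
            enorm (A *m x - b) <= C * tau0
          & enorm x <= E0].
Proof.
case: N hN hM => // n _ _; case: s hs => // s _.
set nb := enorm (rhs T n.+1 s.+1 f).
have nb0 : 0 <= nb by exact: enorm_ge0.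
(* The solution is [x2], of norm at most D, plus a correction of norm at most nb + C; the factor 2
   covers the loss in [sqnD_le]. *)
exists (2 * (D + nb + C)); first by lra.
move=> tau t0 eps A b [xt [rxt xtD]].
have [eps0 lamE] := shape_param_exponent n hT t0.
have T0 : 0 < T by lra.
have tV : 0 < tau^-1 by rewrite invr_gt0.
have Q_lb v : (1 + tau ^- 2)^-1 * sqn v <=
    sqn (Pi n.+1 s.+1 *m Ac T n.+1 s.+1 eps *m v).
  by rewrite -lamE; exact: sqn_Pi_Ac_ge.
have lam0 : 0 < (1 + tau ^- 2)^-1 by rewrite invr_gt0 addr_gt0// invr_gt0 exprn_gt0.
have EE := restriction_trmx T n.+1 s.+1.
have AE : A = restriction T n.+1 s.+1 *m (Pi n.+1 s.+1 *m Ac T n.+1 s.+1 eps).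
  by rewrite mulmxA.
rewrite (Zstar_real (gram_unit lam0 Q_lb)); set Z := _ *m _^T.
(* Once C tau exceeds |b| the choice x2 = 0 keeps |b - A x2| bounded in tau. *)
have [x2 [x2D rC rb]] : exists x2 : 'cV[R]_n.+1,
    [/\ enorm x2 <= D, enorm (b - A *m x2) <= C * tau & enorm (b - A *m x2) <= nb].
  have [bC|bC] := leP nb (C * tau); last first.
    by exists xt; split=> //; apply: le_trans rxt _; exact: ltW.
  exists 0; rewrite mulmx0 subr0 lexx; split=> //.
  by rewrite enorm_le ?(ltW hD)// /sqn big1 ?sqr_ge0// => i _; rewrite mxE expr0n.
set r := b - A *m x2 in rC rb.
have Ct0 : 0 <= C * tau by rewrite mulr_ge0 ?(ltW hC) ?(ltW t0).
have res : enorm (r - A *m (Z *m r)) <= C * tau.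
  apply: le_trans rC; rewrite enorm_le ?enorm_ge0// enorm_sqr AE.
  exact: sqn_AZ_residual lam0 Q_lb EE r.
exists x2, (x2 + Z *m r); split.
- exact: AZ_solution_real.
- rewrite (_ : _ - b = - (r - A *m (Z *m r))); last first.
    by rewrite mulmxDr opprB /r opprB addrCA addrA.
  by rewrite enorm_le// /sqn; under eq_bigr do rewrite mxE sqrrN; rewrite -enorm_le.
(* The factor 1 + tau^(-2) is at most (1 + tau^(-1))^2, and |r| (1 + tau^(-1)) <= nb + C because |r|
   is bounded both by nb and by C tau. *)
have corr : sqn (Z *m r) <= (nb + C) ^+ 2.
  have := sqn_AZ_correction lam0 Q_lb EE r.
  rewrite mulrC ler_pdivrMr; last by rewrite -invr_gt0.
  move/le_trans; apply; rewrite -enorm_sqr -exprVn.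
  apply: (@le_trans _ _ (enorm r ^+ 2 * (1 + tau^-1) ^+ 2)).
    by rewrite ler_wpM2l ?sqr_ge0//; lra.
  rewrite -exprMn; apply: lerXn2r; rewrite ?nnegrE ?mulr_ge0 ?enorm_ge0 ?addr_ge0 ?(ltW tV) ?(ltW hC)//.
  rewrite mulrDr mulr1 lerD//.
  by rewrite ler_pdivrMr.
have x2D2 : sqn x2 <= D ^+ 2 by rewrite -enorm_le ?(ltW hD).
rewrite enorm_le; last lra.
apply: (le_trans (sqnD_le _ _)); nra.
Qed.
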